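(* Let $G$ be a cyclically $4$-edge-connected cubic graph with colouring defect $\operatorname{df}(G)=3$. Then $\pi(G)=4$, unless $G$ is the Petersen graph.
   Context: Graphs may have multiple edges and loops. A connected graph $G$ is cyclically $k$-edge-connected if the removal of fewer than $k$ edges cannot leave a subgraph with at least two components containing circuits. The colouring defect $\operatorname{df}(G)$ of a bridgeless cubic graph $G$ is the minimum, over all collections $\{M_1,M_2,M_3\}$ of three (not necessarily distinct) perfect matchings of $G$, of the number of edges of $G$ belonging to none of $M_1,M_2,M_3$. The perfect matching index $\pi(G)$ is the smallest number of perfect matchings of $G$ whose union contains all edges of $G$. *)

(* Defs.v *)
(* Finite multigraphs (loops and parallel edges allowed):
   a graph is given by finite types V (vertices), E (edges) and an
   incidence map ends : E -> V * V (the two ends of each edge; a loop has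
   equal ends). *)
From mathcomp Require Import all_boot.
Set Implicit Arguments. Unset Strict Implicit. Unset Printing Implicit Defensive.

Section Graphs.
Variables (V E : finType) (ends : E -> V * V).

(* degree of v in the spanning subgraph with edge set F (a loop counts twice) *)
Definition deg (F : {set E}) (v : V) : nat :=
  #|[set e in F | (ends e).1 == v]| + #|[set e in F | (ends e).2 == v]|.

Definition cubic : Prop := forall v, deg setT v = 3.

Definition adj (F : {set E}) : rel V :=
  fun u v => [exists e in F, (ends e == (u, v)) || (ends e == (v, u))].

Definition connected : Prop := forall u v, connect (adj setT) u v.

Definition bridgeless : Prop :=
  forall e, connect (adj (~: [set e])) (ends e).1 (ends e).2.

(* a circuit in the subgraph with edge set F: distinct vertices
   vs_0 .. vs_{n-1} and distinct edges es_0 .. es_{n-1} of F (n >= 1)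
   with es_i joining vs_i and vs_{i+1 mod n}. (n = 1: loop, n = 2: two
   parallel edges.) *)
Definition circuit (F : {set E}) (vs : seq V) (es : seq E) : Prop :=
  [/\ size vs = size es, 0 < size es, uniq vs & uniq es] /\
  all (fun e => e \in F) es /\
      forall i, i < size es -> forall x0 : V, forall e0 : E,
        let a := nth x0 vs i in
        let b := nth x0 vs ((i.+1) %% size es) in
        (ends (nth e0 es i) == (a, b)) || (ends (nth e0 es i) == (b, a)).

Definition comp_has_circuit (F : {set E}) (x : V) : Prop :=
  exists vs es, circuit F vs es /\ all (connect (adj F) x) vs.

Definition cyc_edge_connected (k : nat) : Prop :=
  connected /\
  forall S : {set E}, #|S| < k ->
    ~ (exists x y, ~~ connect (adj (~: S)) x y /\
                   comp_has_circuit (~: S) x /\ comp_has_circuit (~: S) y).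

Definition perfect_matching (M : {set E}) : Prop := forall v, deg M v = 1.

Definition colouring_defect (d : nat) : Prop :=
  (exists M1 M2 M3, [/\ perfect_matching M1, perfect_matching M2,
      perfect_matching M3 & #|~: (M1 :|: M2 :|: M3)| = d]) /\
  (forall M1 M2 M3, perfect_matching M1 -> perfect_matching M2 ->
      perfect_matching M3 -> d <= #|~: (M1 :|: M2 :|: M3)|).

Definition covers (s : seq {set E}) : Prop :=
  forall e : E, exists2 M, M \in s & e \in M.

Definition pm_index (n : nat) : Prop :=
  (exists s : seq {set E}, [/\ size s = n, forall M, M \in s -> perfect_matching M
                              & covers s]) /\
  (forall s : seq {set E}, (forall M, M \in s -> perfect_matching M) ->
      covers s -> n <= size s).

End Graphs.

Definition graph_iso (V E : finType) (ends : E -> V * V)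
  (V' E' : finType) (ends' : E' -> V' * V') : Prop :=
  exists (fV : V -> V') (fE : E -> E'), [/\ bijective fV, bijective fE &
    forall e, ends' (fE e) = (fV (ends e).1, fV (ends e).2) \/
              ends' (fE e) = (fV (ends e).2, fV (ends e).1)].

(* The Petersen graph: outer 5-cycle 0..4, spokes i--i+5, inner pentagram
   5+i -- 5+(i+2 mod 5). *)
Definition petersen_list : seq (nat * nat) :=
  [:: (0,1); (1,2); (2,3); (3,4); (4,0);
      (0,5); (1,6); (2,7); (3,8); (4,9);
      (5,7); (7,9); (9,6); (6,8); (8,5)].

Definition petersen_ends (e : 'I_15) : 'I_10 * 'I_10 :=
  let p := nth (0, 0) petersen_list e in (inord p.1, inord p.2).

(* Main.v *)
(* Three perfect matchings leaving three edges uncovered form a hexagon [C] in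
   which uncovered and doubly covered edges alternate.  If [G - C] has a perfect
   matching, adding the uncovered edges to it gives the fourth matching.
   Otherwise Tutte's theorem and cyclic connectivity make [G - C] bipartite with
   parts [S] and [T], [#|T| = #|S| + 2], all six edges leaving [C] ending in [T].
   If the outer neighbours [t0], [t3] of two opposite vertices [v0], [v3] of [C]
   differ, an alternating path turns a given matching into a perfect matching
   through [v0 t0] and [v3 t3]; its complement is a bipartite 2-factor, so [G] is
   3-edge-colourable, which defect 3 forbids.  So opposite vertices of [C] share
   their outer neighbour, [C] and these three vertices have a 3-edge boundary,
   and what remains is a single vertex: [G] is the Petersen graph. *)
Require Import Defs.
From mathcomp Require Import all_boot.
From mathcomp Require Import zify.
Set Implicit Arguments. Unset Strict Implicit. Unset Printing Implicit Defensive.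

(** * Tutte's theorem *)

(** Six is the number of darts of the three uncovered edges: a vertex misses as many edges as its
    matchings repeat, so, once no edge is covered three times, six vertices carry one uncovered and
    one doubly covered edge each. Cyclic connectivity enters only as a statement on cuts: at least
    three edges leave any proper nonempty vertex set, and exactly three leave it only if one side is
    a single vertex. The main obstacle is that the given matchings provide, for each hexagon vertex,
    a perfect matching through its outer edge, but none through two prescribed outer edges; the
    second one is gained by moving an exposed vertex along an alternating path. Matchings are
    handled as involutions on vertices, which is faithful only in a simple graph. Loops are excluded
    by the cut condition, and parallel edges survive it only in the graph with two vertices and
    three edges, where three matchings cover everything. That three matchings never cover all edges
    also gives the lower bound on the index. *)

Definition flip i := if odd i then i.-1 else i.+1.

Lemma flipK : involutive flip.
Proof. by move=> i; rewrite /flip; case oi: (odd i); case: i oi => //= i; [move/negbTE=> ->|move=> ->]. Qed.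

Lemma flip_lt n i : ~~ odd n -> i < n -> flip i < n.
Proof.
move=> on; rewrite /flip; case: ifP => oi; first lia.
by rewrite leq_eqVlt => /predU1P[E|//]; move: on; rewrite -E /= oi.
Qed.

Section Matchings.
Variable T : finType.
Implicit Types (e : rel T) (f g : T -> T) (S W : {set T}).

(** A perfect matching of a simple graph, as the map sending each vertex to its partner;
    irreflexivity of [e] excludes fixed points. *)
Definition pm e f := involutive f /\ forall x, e x (f x).

(** The basic exchange: the pairs [p], [f p] and [r], [f r] become [p], [r] and [f p], [f r]. *)
Definition repair f p r : T -> T := fun z =>
  if z == p then r else if z == r then p else
  if z == f p then f r else if z == f r then f p else f z.

Lemma repair_invol f p r :
  involutive f -> (forall x, f x != x) -> r != p -> r != f p ->
  involutive (repair f p r) /\ (forall x, repair f p r x != x).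
Proof.
move=> fK fN rp rfp.
have fI := inv_inj fK.
have pfr : p != f r by apply: contraNneq rfp => ->; rewrite fK.
have frfp : f r != f p by rewrite (inj_eq fI).
have pfp : p != f p by rewrite eq_sym fN.
have rfr : r != f r by rewrite eq_sym fN.
split=> z; rewrite /repair.
  have [->|zp] := eqVneq z p; first by rewrite (negbTE rp) eqxx.
  have [->|zr] := eqVneq z r; first by rewrite eqxx.
  have [->|zfp] := eqVneq z (f p).
    by rewrite eq_sym (negbTE pfr) eq_sym (negbTE rfr) (negbTE frfp) eqxx.
  have [->|zfr] := eqVneq z (f r).
    by rewrite eq_sym (negbTE pfp) eq_sym (negbTE rfp) eqxx.
  rewrite fK !(inj_eq fI) (negbTE zp) (negbTE zr).
  have -> : (f z == p) = false by apply: contraNF zfp => /eqP <-; rewrite fK.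
  by have -> : (f z == r) = false by apply: contraNF zfr => /eqP <-; rewrite fK.
have [->//|zp] := eqVneq z p.
have [->|zr] := eqVneq z r; first by rewrite eq_sym.
have [->//|zfp] := eqVneq z (f p).
by have [->|//] := eqVneq z (f r); rewrite eq_sym.
Qed.

Definition has_pm e := [exists f : {ffun T -> T}, [forall x, (f (f x) == x) && e x (f x)]].

Lemma has_pmP e : reflect (exists f, pm e f) (has_pm e).
Proof.
apply: (iffP existsP) => [[f /forallP fP]|[f [fK fe]]].
  by exists f; split=> x; have /andP[/eqP] := fP x.
by exists (finfun f); apply/forallP => x; rewrite !ffunE fK eqxx fe.
Qed.

Lemma even_involution : ~~ odd #|T| ->
  exists f : T -> T, involutive f /\ forall x, f x != x.
Proof.
move=> ev.
pose f x := enum_val (Ordinal (flip_lt ev (ltn_ord (enum_rank x)))).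
exists f; split=> x.
  rewrite /f enum_valK; rewrite -[RHS]enum_rankK; congr enum_val.
  by apply: val_inj => /=; rewrite flipK.
apply/eqP => /(congr1 enum_rank); rewrite /f enum_valK => /(congr1 val) /=.
by rewrite /flip; case: ifP; case: (val _) => //= n _; lia.
Qed.

(** Pairs [x], [f x] are deleted from [W] until only [a], whose partner lies outside, is left. *)
Lemma card_odd_invol_fix f W a : involutive f -> a \in W ->
  (forall x, x \in W -> x != a -> f x \in W) -> (forall x, x \in W -> f x != x) -> f a \notin W ->
  odd #|W|.
Proof.
move=> fK; have [n] := ubnP #|W|; elim: n W => // n IH W ltW aW fW fN faW.
have [E|[x]] := set_0Vmem (W :\ a); first by rewrite (cardsD1 a) aW E cards0.
rewrite !inE => /andP[xa xW].
have fxW := fW x xW xa.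
have fxa : f x != a by apply: contraNneq faW => <-; rewrite fK.
have fxx := fN x xW.
rewrite (cardsD1 x) xW (cardsD1 (f x)) !inE fxx fxW /= negbK.
apply: IH.
- move: ltW; rewrite (cardsD1 x) xW (cardsD1 (f x)) !inE fxx fxW /=; lia.
- by rewrite !inE aW ![a == _]eq_sym fxa xa.
- move=> y; rewrite !inE => /and3P[yfx yx yW] ya; rewrite (fW y yW ya).
  rewrite (inj_eq (inv_inj fK)) yx /= andbT.
  by apply: contraNneq yfx => <-; rewrite fK.
- by move=> y; rewrite !inE => /and3P[_ _ yW]; apply: fN.
by rewrite !inE (negbTE faW) !andbF.
Qed.

Definition add_edge e a c : rel T :=
  fun x y => [|| e x y, (x == a) && (y == c) | (x == c) && (y == a)].

Lemma add_edge_sym e a c : symmetric e -> symmetric (add_edge e a c).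
Proof.
by move=> es x y; rewrite /add_edge es; case: (x == a); case: (x == c); case: (y == a); case: (y == c); rewrite ?orbT ?orbF.
Qed.

Lemma repairE1 f p r : repair f p r p = r.
Proof. by rewrite /repair eqxx. Qed.

Lemma repairE2 f p r : repair f p r r = p.
Proof. by rewrite /repair eqxx; case: eqVneq. Qed.

Lemma repairE3 f p r : (forall x, f x != x) -> r != f p -> repair f p r (f p) = f r.
Proof. by move=> fN rfp; rewrite /repair (negbTE (fN p)) eq_sym (negbTE rfp) eqxx. Qed.

Lemma repairE4 f p r : involutive f -> (forall x, f x != x) -> r != p -> r != f p ->
  repair f p r (f r) = f p.
Proof.
move=> fK fN rp rfp; rewrite /repair (negbTE (fN r)) eqxx (inj_eq (inv_inj fK)) (negbTE rp).
by case: eqVneq => // E; rewrite -E fK eqxx in rfp.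
Qed.

Lemma repairE f p r x : x != p -> x != r -> x != f p -> x != f r -> repair f p r x = f x.
Proof. by rewrite /repair => /negbTE-> /negbTE-> /negbTE-> /negbTE->. Qed.

(* Each step re-pairs [g] along the edge of [f] at [d], which moves the missing
   edge [b d] along the alternating path and increases the agreement with [f]. *)
Lemma alternating_pm e f g a b c d : symmetric e -> irreflexive e ->
  involutive f -> f a = c -> (forall x, x != a -> x != c -> e x (f x)) ->
  involutive g -> g b = d -> (forall x, x != b -> x != d -> e x (g x)) ->
  e b a -> e b c -> ~~ e b d -> b != d ->
  exists h, pm e h.
Proof.
move=> es ei fK fa fe; have [n] := ubnP #|[set x | f x != g x]|.
elim: n g d => // n IH g d; rewrite ltnS => lefg gK gb ge eba ebc ebd bd.
have gd : g d = b by rewrite -gb gK.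
have gN x : g x != x.
  have [->|xb] := eqVneq x b; first by rewrite gb eq_sym.
  have [->|xd] := eqVneq x d; first by rewrite gd.
  by apply: contraTneq (ge x xb xd) => ->; rewrite ei.
have da : d != a by apply: contraNneq ebd => ->.
have dc : d != c by apply: contraNneq ebd => ->.
have edy := fe d da dc; set y := f d in edy.
have yb : y != b by apply: contraNneq ebd => <-; rewrite es.
have yd : y != d by apply: contraTneq edy => ->; rewrite ei.
have eyz := ge y yb yd; set z := g y in eyz.
have zd : z != d by apply: contraNneq yb => E; rewrite -(gK y) -/z E gd.
have zb : z != b by apply: contraNneq yd => E; rewrite -(gK y) -/z E gb.
have ygd : y != g d by rewrite gd.
have [hK hN] := repair_invol gK gN yd ygd.
have hd : repair g d y d = y by exact: repairE1.
have hy : repair g d y y = d by exact: repairE2.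
have hb : repair g d y b = z by rewrite -gd repairE3.
have hz : repair g d y z = b by rewrite repairE4.
have he x : x != b -> x != z -> e x (repair g d y x).
  move=> xb xz; have [->|xd] := eqVneq x d; first by rewrite hd.
  have [->|xy] := eqVneq x y; first by rewrite hy es.
  by rewrite repairE ?gd // ge.
(* In the exchanged matching only the pair [b], [z] may fail to be an edge: either it is one, or [z]
   takes over the role of [d]. *)
have [ebz|nebz] := boolP (e b z).
  exists (repair g d y); split=> // x.
  have [->|xb] := eqVneq x b; first by rewrite hb.
  have [->|xz] := eqVneq x z; first by rewrite hz es.
  exact: he.
apply: (IH (repair g d y) z) => //; last by rewrite eq_sym.
apply: leq_trans lefg; apply: proper_card.
apply/properP; split; last first.
  by exists d; rewrite !inE ?hd ?eqxx // gd.
apply/subsetP => x; rewrite !inE.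
have [->|xd] := eqVneq x d; first by rewrite hd eqxx.
have [->|xy] := eqVneq x y; first by rewrite hy /y fK eqxx.
have [->|xb] := eqVneq x b.
  by rewrite gb => _; apply: contraNneq yb => E; rewrite /y -E fK.
have [->|xz] := eqVneq x z.
  by rewrite /z gK -/z => _; apply: contraNneq zd => E; rewrite -(fK z) E /y fK.
by rewrite repairE ?gd.
Qed.

(** [a], [p], [f p], [c] is an augmenting path: its two outer edges replace the pair [a], [c] and
    the pair [p], [f p]. *)
Lemma augment_pm e f a c p : symmetric e -> irreflexive e -> a != c ->
  involutive f -> f a = c -> (forall x, x != a -> x != c -> e x (f x)) ->
  p != a -> p != c -> e a p -> e c (f p) ->
  exists h, pm e h.
Proof.
move=> es ei ac fK fa fe pa pc eap ecfp.
have fc : f c = a by rewrite -fa fK.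
have fN x : f x != x.
  have [->|xa] := eqVneq x a; first by rewrite fa eq_sym.
  have [->|xc] := eqVneq x c; first by rewrite fc.
  by apply: contraTneq (fe x xa xc) => ->; rewrite ei.
have pfa : p != f a by rewrite fa.
have [hK hN] := repair_invol fK fN pa pfa.
exists (repair f a p); split=> // x.
have [->|xa] := eqVneq x a; first by rewrite repairE1.
have [->|xp] := eqVneq x p; first by rewrite repairE2 es.
have [->|xc] := eqVneq x c; first by rewrite -fa repairE3 // fa.
have [->|xfp] := eqVneq x (f p); first by rewrite repairE4 // fa es.
by rewrite repairE ?fa // fe.
Qed.

(** [cls] stands for a component labelling of the graph without [S]. Where it is used, it is only
    required to be constant along edges avoiding [S], so a class is a union of components. *)
Definition odd_classes S (cls : T -> T) : {set T} :=
  [set k | odd #|[set x in ~: S | cls x == k]|].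

(** Lovasz's argument for an edge-maximal graph. [U] collects the vertices adjacent to all others;
    outside [U] adjacency is transitive, so components are cliques. The count is read off a matching
    [f] whose only bad pair is a non-edge [a c]: [a], [c] and the partners of [U] are pairwise
    non-adjacent, and each is the only vertex of its clique not matched inside it, which makes the
    clique odd. *)
Lemma tutte_saturated e : symmetric e -> irreflexive e -> ~~ odd #|T| ->
  (forall h, ~ pm e h) ->
  (forall a c, a != c -> ~~ e a c -> exists f, pm (add_edge e a c) f) ->
  exists S (cls : T -> T),
    (forall x y, x \notin S -> y \notin S -> e x y -> cls x = cls y) /\
    #|S| + 2 <= #|odd_classes S cls|.
Proof.
move=> es ei ev nopm sat.
have miss a c : a != c -> ~~ e a c -> exists f,
    [/\ involutive f, f a = c & forall x, x != a -> x != c -> e x (f x)].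
  move=> ac nac; have [f [fK fe]] := sat a c ac nac; exists f.
  have fe' x : x != a -> x != c -> e x (f x).
    by move=> /negbTE xa /negbTE xc; have := fe x; rewrite /add_edge xa xc /= orbF.
  split=> //; apply/eqP; apply: contraT => fac; case: (nopm f); split=> // x.
  have := fe x; case/or3P=> // /andP[/eqP-> /eqP E].
    by rewrite E eqxx in fac.
  by rewrite -E fK eqxx in fac.
have [U [inU notU]] : exists U : {set T}, (forall u x, u \in U -> x != u -> e x u) /\
    (forall u, u \notin U -> exists2 w, u != w & ~~ e u w).
  exists [set x | [forall y, (y != x) ==> e x y]]; split=> u.
    by move=> x; rewrite inE => /forallP/(_ x)/implyP H xu; rewrite es H.
  by rewrite inE negb_forall => /existsP[w]; rewrite negb_imply eq_sym => /andP[]; exists w.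
(* If [x z] were missing, a matching whose only bad pair is [x z] and one whose only bad pair is
   [y w] would combine into a perfect matching. *)
have trans x y z : y \notin U -> e y x -> e y z -> x != z -> e x z.
  move=> /notU[w yw nyw] eyx eyz xz; apply: contraT => nxz.
  have [f [fK fx fe]] := miss x z xz nxz.
  have [g [gK gy ge]] := miss y w yw nyw.
  by have [h /nopm] := alternating_pm es ei fK fx fe gK gy ge eyx eyz nyw yw.
pose r x y := (x == y) || e x y.
have rsym x y : r x y = r y x by rewrite /r eq_sym es.
have rtrans x y z : y \notin U -> r x y -> r y z -> r x z.
  move=> yU; rewrite /r es => /predU1P[->//|eyx] /predU1P[<-|eyz]; first by rewrite es eyx orbT.
  by case: eqVneq => //= xz; apply: trans yU eyx eyz xz.
(* The label is a vertex of the clique of [x], picked by a predicate that depends on the clique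
   alone; outside [U] the default is never reached. *)
pose cls x := odflt x [pick y in ~: U | r x y].
have clsP x : x \notin U -> cls x \notin U /\ r x (cls x).
  rewrite /cls => xU; case: pickP => [y|/(_ x)]; first by rewrite inE => /andP[].
  by rewrite inE xU /r eqxx.
have clsE x y : x \notin U -> y \notin U -> r x y -> cls x = cls y.
  move=> xU yU rxy; rewrite /cls.
  have E : (fun z => (z \in ~: U) && r x z) =1 (fun z => (z \in ~: U) && r y z).
    move=> z; apply: andb_id2l; rewrite inE => zU.
    by apply/idP/idP; apply: rtrans; rewrite // rsym.
  rewrite (eq_pick E); case: pickP => // /(_ y).
  by rewrite inE yU /r eqxx.
have clsI x y : x \notin U -> y \notin U -> cls x = cls y -> r x y.
  move=> xU yU E; have [cU rx] := clsP x xU; have [_ ry] := clsP y yU.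
  by apply: rtrans rx _ => //; rewrite rsym E.
have [|[a [c [ac nac]]]] : (forall a c, a != c -> e a c) \/ exists a c, a != c /\ ~~ e a c.
- have [/existsP[a /existsP[c /andP[]]]|H] := boolP [exists a, exists c, (a != c) && ~~ e a c].
    by right; exists a, c.
  left=> a c ac; apply: contraNT H => nac; apply/existsP; exists a.
  by apply/existsP; exists c; rewrite ac.
- move=> full; have [f [fK fN]] := even_involution ev.
  by case: (nopm f); split=> // x; apply: full; rewrite eq_sym.
have [f [fK fa fe]] := miss a c ac nac.
have fc : f c = a by rewrite -fa fK.
have fN x : f x != x.
  have [->|xa] := eqVneq x a; first by rewrite fa eq_sym.
  have [->|xc] := eqVneq x c; first by rewrite fc.
  by apply: contraTneq (fe x xa xc) => ->; rewrite ei.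
have aU : a \notin U by apply: contra nac => aU; rewrite es inU // eq_sym.
have cU : c \notin U by apply: contra nac => cU; rewrite inU.
have neU u x : u \in U -> x \notin U -> x != u by move=> uU; apply: contraNneq => ->.
have neU' u x : u \in U -> x \notin U -> u != x by move=> uU xU; rewrite eq_sym neU.
have fU u : u \in U -> f u \notin U.
  move=> uU; apply/negP => fuU.
  by have [||||h /nopm] := augment_pm (p := u) es ei ac fK fa fe; auto.
pose X := [set x in ~: U | [|| x == a, x == c | f x \in U]].
have indep1 p x y : p \in U -> x \notin U -> y = f p -> e x y -> x \notin [set a; c].
  move=> pU xU -> exy; rewrite !inE negb_or; apply/andP; split; apply/eqP => E; subst x.
    have fpa : f p != a by apply: contraNneq cU => E; rewrite -fa -E fK.
    have fpc : f p != c by apply: contraNneq aU => E; rewrite -fc -E fK.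
    by have [|h /nopm] := augment_pm (p := f p) es ei ac fK fa fe fpa fpc exy; rewrite ?fK; auto.
  by have [||||h /nopm] := augment_pm (p := p) es ei ac fK fa fe; auto.
have indep x y : x \in X -> y \in X -> x != y -> ~~ e x y.
  rewrite !inE => /andP[xU Hx] /andP[yU Hy] xy; apply/negP => exy.
  have Fx : f x \in U -> x \notin [set a; c].
    by rewrite !inE => H; apply: contraTN H => /orP[]/eqP->; rewrite ?fa ?fc.
  have [fxU|nfxU] := boolP (f x \in U); last first.
    have xac : x \in [set a; c] by rewrite !inE; case/or3P: Hx nfxU => [->|->|->] //; rewrite ?orbT.
    have [fyU|nfyU] := boolP (f y \in U).
      by move: (indep1 (f y) x y fyU xU); rewrite fK xac => /(_ erefl exy).
    have yac : y \in [set a; c] by rewrite !inE; case/or3P: Hy nfyU => [->|->|->] //; rewrite ?orbT.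
    move: xac yac xy exy; rewrite !inE => /orP[]/eqP-> /orP[]/eqP->; rewrite ?eqxx //.
      by rewrite (negbTE nac).
    by rewrite es (negbTE nac).
  have [fyU|nfyU] := boolP (f y \in U); last first.
    have yac : y \in [set a; c] by rewrite !inE; case/or3P: Hy nfyU => [->|->|->] //; rewrite ?orbT.
    by move: (indep1 (f x) y x fxU yU); rewrite fK yac es => /(_ erefl exy).
  have xac := Fx fxU; move: xac; rewrite !inE negb_or => /andP[xa xc].
  have yac : y \notin [set a; c].
    by rewrite !inE; apply: contraTN fyU => /orP[]/eqP->; rewrite ?fa ?fc.
  move: yac; rewrite !inE negb_or => /andP[ya yc].
  (* Pairing [a] with [x], and [c] with the universal vertex [f x], moves the missing edge to [a x];
     then [a], [f y], [y], [x] is an augmenting path. *)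
  have xfa : x != f a by rewrite fa.
  have [gK gN] := repair_invol fK fN xa xfa.
  have ga : repair f a x a = x by exact: repairE1.
  have ge z : z != a -> z != x -> e z (repair f a x z).
    move=> za zx; have [->|zc] := eqVneq z c.
      by rewrite -{2}fa repairE3 //; apply: inU; auto.
    have [->|zfx] := eqVneq z (f x).
      by rewrite repairE4 // fa es; apply: inU; auto.
    by rewrite repairE ?fa // fe.
  have fyx : f y != x by apply: neU'.
  have fya : f y != a by apply: neU'.
  have fyc : f y != c by apply: neU'.
  have gfy : repair f a x (f y) = y.
    by rewrite repairE ?fa ?fK // (inj_eq (inv_inj fK)) eq_sym.
  have ax : a != x by rewrite eq_sym.
  have eafy : e a (f y) by apply: inU; auto.
  have exg : e x (repair f a x (f y)) by rewrite gfy.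
  by have [h /nopm] := augment_pm es ei ax gK ga ge fya fyx eafy exg.
have XU x : x \in X -> x \notin U by rewrite !inE => /andP[].
have clsX : {in X &, injective cls}.
  move=> x y xX yX /(clsI _ _ (XU _ xX) (XU _ yX)) /predU1P[//|exy].
  by apply: contraTeq exy => /(indep x y xX yX).
exists U, cls; split; first by move=> x y xU yU exy; apply: clsE; rewrite // /r exy orbT.
apply: (@leq_trans #|X|).
  have -> : #|U| + 2 = #|[set a; c] :|: f @: U|.
    rewrite cardsU (card_imset _ (inv_inj fK)) cards2 ac.
    suff -> : [set a; c] :&: f @: U = set0 by rewrite cards0 subn0 addnC.
    apply/setP => x; rewrite !inE; apply/negP => /andP[xac /imsetP[u uU E]]; subst x.
    case/orP: xac => /eqP E; move: uU; rewrite -(fK u) E ?fa ?fc.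
      by rewrite (negbTE cU).
    by rewrite (negbTE aU).
  apply: subset_leq_card; apply/subsetP => x; rewrite !inE => /orP[/orP[]/eqP->|/imsetP[u uU ->]].
  - by rewrite aU eqxx.
  - by rewrite cU eqxx orbT.
  by rewrite fK uU fU // !orbT.
rewrite -(card_in_imset clsX); apply: subset_leq_card; apply/subsetP => _ /imsetP[x xX ->].
have xU := XU x xX.
(* Any other vertex [z] of the clique is outside the independent set [X], so [f z] is not in [U] and
   stays in the clique. *)
rewrite inE; apply: (@card_odd_invol_fix f _ x) => //.
- by rewrite !inE xU eqxx.
- move=> z; rewrite !inE => /andP[zU /eqP E] zx.
  have rzx := clsI z x zU xU E.
  have zX : z \notin X.
    apply: contraTN rzx => zX; rewrite /r negb_or zx; exact: indep.
  move: zX; rewrite !inE zU /= !negb_or => /and3P[za zc fzU]; rewrite fzU /=.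
  by rewrite -E; apply/eqP; apply: clsE; rewrite // /r es fe ?orbT.
rewrite !inE; have := xX; rewrite !inE xU /= => /or3P[/eqP->|/eqP->|->//].
  by rewrite fa cU; apply/negP => /eqP/clsI; rewrite /r eq_sym (negbTE ac) es (negbTE nac); auto => /(_ cU aU).
by rewrite fc aU; apply/negP => /eqP/clsI; rewrite /r (negbTE ac) (negbTE nac) => /(_ aU cU).
Qed.

(** Induction on the number of non-edges: a barrier for a graph with one more edge is also a barrier
    for [e], and when every added edge creates a perfect matching the graph is saturated. *)
Theorem tutte e : symmetric e -> irreflexive e -> ~~ odd #|T| ->
  (exists f, pm e f) \/
  exists S (cls : T -> T),
    (forall x y, x \notin S -> y \notin S -> e x y -> cls x = cls y) /\
    #|S| + 2 <= #|odd_classes S cls|.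
Proof.
have [n] := ubnP #|[set p : T * T | ~~ e p.1 p.2]|.
elim: n e => // n IH e; rewrite ltnS => len es ei ev.
case: (has_pmP e) => [|nopm]; [by left|right].
have [/existsP[a /existsP[c /and3P[ac nac /has_pmP npm]]]|H] :=
  boolP [exists a, exists c, [&& a != c, ~~ e a c & ~~ has_pm (add_edge e a c)]].
  have [|||//|//|[S [cls [Hc Ho]]]] := IH (add_edge e a c).
  - apply: leq_trans len; apply: proper_card; apply/properP; split.
      by apply/subsetP => p; rewrite !inE /add_edge negb_or => /andP[].
    by exists (a, c); rewrite !inE //= /add_edge !eqxx orbT.
  - exact: add_edge_sym.
  - move=> x; rewrite /add_edge ei /=.
    by apply/negP => /orP[]/andP[/eqP-> /eqP E]; rewrite E eqxx in ac.
  by exists S, cls; split=> // x y xS yS exy; apply: Hc; rewrite // /add_edge exy.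
apply: tutte_saturated => // [h hp|a c ac nac]; first by apply: nopm; exists h.
apply/has_pmP; apply: contraNT H => H; apply/existsP; exists a; apply/existsP; exists c.
by rewrite ac nac.
Qed.
End Matchings.

(** * Circuits and edge cuts in multigraphs *)

Section Multigraph.
Variables (V E : finType) (ends : E -> V * V).
Implicit Types (F : {set E}) (W : {set V}) (p : seq (E * V)).

Definition joins e u v := (ends e == (u, v)) || (ends e == (v, u)).

Lemma joinsC e u v : joins e u v = joins e v u.
Proof. by rewrite /joins orbC. Qed.

(** Each entry of [p] is an edge together with the vertex it leads to. Trails are prolonged at the
    head [v]. *)
Fixpoint trail F v p := match p with
  | [::] => true
  | (e, w) :: p' => [&& e \in F, joins e v w & trail F w p']
  end.

Lemma trail_nth F v p i x0 e0 : trail F v p -> i < size p ->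
  joins (nth e0 (map fst p) i) (nth x0 (v :: map snd p) i) (nth x0 (map snd p) i).
Proof.
elim: p v i => // [[e w] p] IH v [|i] /= /and3P[_ jo tr] ip //.
exact: IH.
Qed.

Lemma trail_sub F v p : trail F v p -> all (fun e => e \in F) (map fst p).
Proof. by elim: p v => // [[e w] p] IH v /= /and3P[-> _ /IH]. Qed.

Lemma trail_catl F v p1 p2 : trail F v (p1 ++ p2) -> trail F v p1.
Proof. by elim: p1 v => // [[e w] p1] IH v /= /and3P[-> -> /IH]. Qed.

Lemma trail_ends F v p e : trail F v p -> e \in map fst p ->
  (ends e).1 \in v :: map snd p /\ (ends e).2 \in v :: map snd p.
Proof.
elim: p v => // [[e' w] p] IH v /= /and3P[_ jo tr]; rewrite inE => /predU1P[->|/IH-/(_ w tr)[]].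
  by case/orP: jo => /eqP->; rewrite !inE !eqxx !orbT.
by rewrite ![_ \in v :: _]inE => -> ->; rewrite !orbT.
Qed.

Lemma trail_uniq F v p : trail F v p -> uniq (v :: map snd p) -> uniq (map fst p).
Proof.
elim: p v => // [[e w] p] IH v /= /and3P[_ jo tr] /andP[vp up].
rewrite (IH w) // andbT; apply/negP => /(trail_ends tr)[].
by case/orP: jo => /eqP-> /=; rewrite (negbTE vp).
Qed.

Lemma loop_circuit F (e : E) v : e \in F -> ends e = (v, v) -> circuit ends F [:: v] [:: e].
Proof. by move=> eF ee; do 2!split=> //=; [rewrite eF|case=> // _ x0 e0; rewrite ee eqxx]. Qed.

Lemma trail_circuit F v p e' : trail F v p -> uniq (v :: map snd p) ->
  p != [::] -> e' \in F -> e' \notin map fst p -> joins e' (last v (map snd p)) v ->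
  circuit ends F (v :: map snd p) (rcons (map fst p) e').
Proof.
move=> tr up pn eF ep jo; split.
  by split; rewrite ?size_rcons /= ?size_map // rcons_uniq ep (trail_uniq tr).
split; first by rewrite all_rcons eF (trail_sub tr).
move=> i; rewrite size_rcons size_map ltnS => ip x0 e0 /=.
rewrite nth_rcons size_map; case: ltngtP ip => // [ip _|-> _].
  by rewrite modn_small //=; apply: trail_nth tr ip.
rewrite modnn /= -(size_map snd p) nth_last; exact: jo.
Qed.

(** A path is prolonged at its head by an edge other than the one just used; finiteness forces a
    return to the path, and that closes a circuit. *)
Lemma mindeg2_circuit F W : W != set0 ->
  (forall e, e \in F -> (ends e).1 \in W /\ (ends e).2 \in W) ->
  (forall v, v \in W -> 2 <= deg ends F v) ->
  exists vs es, circuit ends F vs es.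
Proof.
move=> /set0Pn[v0 v0W] FW dW.
suff ext n v p : #|V| - size p <= n -> trail F v p -> uniq (v :: map snd p) -> v \in W ->
    exists vs es, circuit ends F vs es.
  by apply: (ext #|V| v0 [::]) => //; rewrite leq_subr.
elim: n v p => [|n IH] v p len tr up vW.
  have := max_card (mem (v :: map snd p)); rewrite (card_uniqP up) /= size_map.
  by move: len; rewrite leqn0 subn_eq0 => Vp /leq_trans/(_ Vp); rewrite ltnn.
have [/existsP[e /andP[eF /eqP ee]]|noloop] := boolP [exists e in F, ends e == (v, v)].
  by exists [:: v], [:: e]; apply: loop_circuit.
pose A := [set e in F | (ends e).1 == v]; pose B := [set e in F | (ends e).2 == v].
have AB : A :&: B = set0.
  apply/setP => e; rewrite !inE; apply: contraNF noloop => /andP[/andP[eF /eqP e1] /andP[_ /eqP e2]].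
  by apply/existsP; exists e; rewrite eF [ends e]surjective_pairing e1 e2 eqxx.
(* [take 1 p] holds the edge just used, or nothing at the start. Without loops at [v], its degree
   counts distinct edges, so another one remains. *)
have [e' e'AB e'p] : exists2 e', e' \in A :|: B & e' \notin map fst (take 1 p).
  have c2 : 2 <= #|A :|: B| by rewrite cardsU AB cards0 subn0; exact: dW.
  have /card_gt0P[e'] : 0 < #|(A :|: B) :\: [set x in map fst (take 1 p)]|.
    rewrite cardsD subn_gt0; apply: leq_trans c2; rewrite ltnS.
    apply: leq_trans (subset_leq_card (subsetIr _ _)) _.
    by rewrite cardsE (leq_trans (card_size _)) // size_map size_take; case: (size p) => [|[]].
  by rewrite !inE => /andP[h1 h2]; exists e'; rewrite // !inE.
have e'F : e' \in F by move: e'AB; rewrite !inE => /orP[]/andP[].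
have [w jo] : exists w, joins e' v w.
  move: e'AB; rewrite !inE /joins; case: (ends e') => a b /= /orP[]/andP[_ /eqP->].
    by exists b; rewrite eqxx.
  by exists a; rewrite eqxx orbT.
have wW : w \in W by have [] := FW e' e'F; case/orP: jo => /eqP->.
have wv : w != v.
  apply: contraNneq noloop => wv; apply/existsP; exists e'; rewrite e'F.
  by move: jo; rewrite wv /joins orbb.
have [wp|wp] := boolP (w \in map snd p); last first.
  apply: (IH w ((e', v) :: p)) => //=.
  - by move: len; rewrite subnS; case: (_ - _).
  - by rewrite e'F joinsC jo tr.
  by rewrite inE negb_or wv wp.
have [[e1 w'] ep /= Ew] := mapP wp; subst w'.
case/splitPr: ep tr up e'p => p1 p2; rewrite -cat_rcons => tr up e'p.
have tr1 := trail_catl tr.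
have up1 : uniq (v :: map snd (rcons p1 (e1, w))).
  by move: up; rewrite map_cat -cat_cons cat_uniq => /andP[].
exists (v :: map snd (rcons p1 (e1, w))), (rcons (map fst (rcons p1 (e1, w))) e').
apply: trail_circuit => //.
- by case: (p1).
(* The closing edge is not the first edge of the segment by its choice, and the later edges do not
   touch [v]. *)
- move: tr1 up1 e'p; case: {tr up wp}(p1) => [|[e2 w2] q] /=; first by rewrite take0.
  rewrite take0 !inE => /and3P[_ _ tr2] /andP[vq _] e'2; rewrite negb_or e'2.
  apply/negP => /(trail_ends tr2)[h1 h2].
  by case/orP: jo => /eqP ee'; [move: h1|move: h2]; rewrite ee' /= inE (negbTE vq).
by rewrite map_rcons last_rcons joinsC.
Qed.

(** Deleting a vertex of degree at most one loses at most one edge and so preserves [#|W| <= #|F|];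
    if there is no such vertex, [mindeg2_circuit] applies. *)
Lemma dense_circuit F W : W != set0 -> #|W| <= #|F| ->
  (forall e, e \in F -> (ends e).1 \in W /\ (ends e).2 \in W) ->
  exists vs es, circuit ends F vs es.
Proof.
have [n] := ubnP #|W|; elim: n W F => // n IH W F; rewrite ltnS => ltW W0 WF FW.
have [/forallP H|] := boolP [forall v in W, 2 <= deg ends F v].
  by apply: mindeg2_circuit W0 FW _ => v; apply/implyP.
rewrite negb_forall => /existsP[v]; rewrite negb_imply -ltnNge ltnS => /andP[vW dv].
pose D := [set e in F | (ends e).1 == v] :|: [set e in F | (ends e).2 == v].
have cD : #|D| <= 1 by apply: leq_trans dv; rewrite /D cardsU leq_subr.
have W1 : W :\ v != set0.
  apply/negP => /eqP W1; have := WF; rewrite (cardsD1 v) vW W1 cards0 => /card_gt0P[e eF].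
  have Wv x : x \in W -> x = v.
    by move=> xW; apply/eqP; apply: contraT => xv; move/setP/(_ x): W1; rewrite !inE xv xW.
  have [/Wv e1 /Wv e2] := FW e eF; move: dv; rewrite /deg.
  have : 0 < #|[set e in F | (ends e).1 == v]| by apply/card_gt0P; exists e; rewrite inE eF e1 eqxx.
  have : 0 < #|[set e in F | (ends e).2 == v]| by apply/card_gt0P; exists e; rewrite inE eF e2 eqxx.
  lia.
have [|||vs [es [H1 [H2 H3]]]] := IH (W :\ v) (F :\: D) _ W1.
- by move: ltW; rewrite (cardsD1 v W) vW; lia.
- have := WF; rewrite (cardsD1 v W) vW (cardsD F); have := subset_leq_card (subsetIr F D); lia.
- move=> e; rewrite !inE => /andP[+ eF]; rewrite eF /= negb_or => /andP[-> ->].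
  by have [-> ->] := FW e eF.
exists vs, es; split=> //; split=> //.
by apply: sub_all H2 => e; rewrite inE => /andP[].
Qed.

Definition cut_edges W := [set e | ((ends e).1 \in W) (+) ((ends e).2 \in W)].
Definition inner_edges W := [set e | ((ends e).1 \in W) && ((ends e).2 \in W)].

Lemma cut_edgesC W : cut_edges (~: W) = cut_edges W.
Proof. by apply/setP => e; rewrite !inE; do 2!case: (_ \in W). Qed.

Lemma deg_sum W : \sum_(v in W) deg ends setT v = (#|inner_edges W|).*2 + #|cut_edges W|.
Proof.
have S (h : E -> V) : \sum_(v in W) #|[set e in setT | h e == v]| = #|[set e | h e \in W]|.
  rewrite -sum1_card (partition_big h (mem W)) /=; last by move=> e; rewrite inE.
  apply: eq_bigr => v vW; rewrite -sum1_card; apply: eq_bigl => e.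
  by rewrite !inE; have [->|_] := eqVneq (h e) v; rewrite ?vW ?andbF.
rewrite /deg big_split /= (S (fun e => (ends e).1)) (S (fun e => (ends e).2)).
have I : [set e | (ends e).1 \in W] :&: [set e | (ends e).2 \in W] = inner_edges W.
  by apply/setP => e; rewrite !inE.
have U : [set e | (ends e).1 \in W] :|: [set e | (ends e).2 \in W] = inner_edges W :|: cut_edges W.
  by apply/setP => e; rewrite !inE; do 2!case: (_ \in W).
have D : inner_edges W :&: cut_edges W = set0.
  by apply/setP => e; rewrite !inE; do 2!case: (_ \in W).
by rewrite -cardsUI I U cardsU D cards0 subn0 -addnn; lia.
Qed.

Lemma circuit_component F vs es W :
  circuit ends F vs es ->
  (forall e, e \in F -> (ends e).1 \in W /\ (ends e).2 \in W) ->
  exists2 x, x \in W & all (connect (adj ends F) x) vs.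
Proof.
case=> [[sz s0 uv ue] [al jo]] FW.
have [e0] : exists e0 : E, True by case: es s0 {sz ue al jo} => [|e0]; [|exists e0].
move=> _; case: vs sz uv jo => [|x vs] sz uv jo; first by rewrite -sz in s0.
have esF i : i < size es -> nth e0 es i \in F by move=> ies; apply: (allP al); rewrite mem_nth.
exists x.
  have [e1 e2] := FW _ (esF 0 s0); have := jo 0 s0 x e0.
  by case/orP=> /eqP ee; rewrite ee in e1 e2.
apply/allP => y /(nthP x)[i]; rewrite sz => + <-.
elim: i => [|i IH] ies; first exact: connect0.
have ies' := ltnW ies; apply: connect_trans (IH ies') _.
apply: connect1; apply/existsP; exists (nth e0 es i); rewrite esF //=.
by have := jo i ies' x e0; rewrite modn_small.
Qed.

Lemma circuitW F F' vs es : F \subset F' -> circuit ends F vs es -> circuit ends F' vs es.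
Proof.
move=> /subsetP FF' [H1 [H2 H3]]; split=> //; split=> //.
by apply: sub_all H2 => e; apply: FF'.
Qed.

Lemma connectW F F' : F \subset F' -> subrel (connect (adj ends F)) (connect (adj ends F')).
Proof.
move=> /subsetP FF'; apply: connect_sub => x y /existsP[e /andP[eF exy]].
by apply: connect1; apply/existsP; exists e; rewrite FF'.
Qed.

(** Since three times [#|W|] is twice the number of inner edges plus the cut, a side with fewer than
    [#|W| + 2] cut edges has at least as many inner edges as vertices, hence a circuit. Both sides
    cannot contain one. With at most three cut edges, the surviving alternative makes a side a
    single vertex. *)
Lemma cut_bound W : cubic ends -> cyc_edge_connected ends 4 -> #|cut_edges W| < 4 ->
  W != set0 -> ~: W != set0 ->
  (#|W| + 2 <= #|cut_edges W|) || (#|~: W| + 2 <= #|cut_edges W|).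
Proof.
move=> cub [_ cyc] c4 W0 W1.
have dense X : #|cut_edges X| < #|X| + 2 -> #|X| <= #|inner_edges X|.
  move=> cX; have := deg_sum X; rewrite (eq_bigr (fun=> 3)) => [|v _]; last exact: cub.
  by rewrite sum_nat_const; lia.
have comp X : X != set0 -> #|cut_edges X| < #|X| + 2 ->
    exists2 x, x \in X & comp_has_circuit ends (~: cut_edges X) x.
  move=> X0 /dense dX.
  have inX e : e \in inner_edges X -> (ends e).1 \in X /\ (ends e).2 \in X.
    by rewrite inE => /andP.
  have [vs [es cir]] := dense_circuit X0 dX inX.
  have sub : inner_edges X \subset ~: cut_edges X.
    by apply/subsetP => e; rewrite !inE; do 2!case: (_ \in X).
  have [x xX conn] := circuit_component cir inX.
  exists x => //; exists vs, es; split; first exact: circuitW cir.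
  by apply: sub_all conn => y; apply: connectW.
apply: contraT; rewrite negb_or -!ltnNge => /andP[cW cW'].
have [x xW cx] := comp W W0 cW.
have [y yW cy] : exists2 y, y \in ~: W & comp_has_circuit ends (~: cut_edges W) y.
  by rewrite -cut_edgesC; apply: comp; rewrite // cut_edgesC.
case: (cyc _ c4); exists x, y; split=> //; apply: contraTN xW => cxy.
have cl : closed (adj ends (~: cut_edges W)) (mem W).
  move=> u v /existsP[e /andP[]]; rewrite !inE => ce /orP[]/eqP ee; move: ce; rewrite ee /=;
    by do 2!case: (_ \in W).
by move: yW; rewrite (closed_connect cl cxy) inE.
Qed.
End Multigraph.

(** * Counting neighbours and cut edges *)

Lemma sum_setU (T : finType) (X Y : {set T}) (F : T -> nat) : [disjoint X & Y] ->
  \sum_(i in X :|: Y) F i = \sum_(i in X) F i + \sum_(i in Y) F i.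
Proof. by move=> dXY; rewrite -bigU //; apply: eq_bigl => i; rewrite !inE. Qed.

Section Neighbours.
Variables (T : finType) (e : rel T).
Hypothesis es : symmetric e.
Implicit Types (S W X Y : {set T}).

Definition nbr X x : nat := \sum_(y in X) (e x y : nat).
Definition cut W := \sum_(x in W) nbr (~: W) x.

Lemma nbr_setC X x : nbr X x + nbr (~: X) x = nbr setT x.
Proof.
by rewrite /nbr [in RHS](big_setID X) /= setTI setTD.
Qed.

Lemma nbrU X Y x : [disjoint X & Y] -> nbr (X :|: Y) x = nbr X x + nbr Y x.
Proof. by move=> dXY; rewrite /nbr sum_setU. Qed.

Lemma nbrS X Y x : X \subset Y -> nbr X x <= nbr Y x.
Proof.
move=> XY; rewrite /nbr [leqRHS](big_setID X) /= (setIidPr XY); exact: leq_addr.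
Qed.

Lemma nbr_eq0 X x y : nbr X x = 0 -> y \in X -> e x y = false.
Proof.
by move/eqP; rewrite sum_nat_eq0 => /forallP/(_ y)/implyP H /H; case: (e x y).
Qed.

Lemma nbr0 X x : (forall y, y \in X -> ~~ e x y) -> nbr X x = 0.
Proof. by move=> H; rewrite /nbr big1 // => y /H/negbTE->. Qed.

Lemma nbr_full X x y : nbr setT x <= nbr X x -> e x y -> y \in X.
Proof.
rewrite -(nbr_setC X x) => le exy; apply: contraTT exy => yX.
rewrite (@nbr_eq0 (~: X)) // ?inE //; lia.
Qed.

Lemma nbr_gt0 X x y : y \in X -> e x y -> 0 < nbr X x.
Proof. by move=> yX exy; rewrite lt0n; apply: contraTneq exy => /nbr_eq0->. Qed.

Lemma nbr_sub_full X x : (forall y, e x y -> y \in X) -> nbr X x = nbr setT x.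
Proof.
move=> H; rewrite -(nbr_setC X x) (@nbr0 (~: X)) ?addn0 // => y; rewrite inE.
by apply: contra => /H.
Qed.

Lemma sum_nbrC X Y : \sum_(x in X) nbr Y x = \sum_(y in Y) nbr X y.
Proof. by rewrite /nbr exchange_big; apply: eq_bigr => y _; apply: eq_bigr => x _; rewrite es. Qed.

Definition class S (cls : T -> T) k := [set x in ~: S | cls x == k].
Definition odd_union S (cls : T -> T) := [set x in ~: S | cls x \in odd_classes S cls].

(** An edge leaving an odd class ends in [S], so both sums count the edges between [S] and the odd
    classes. *)
Lemma odd_cut_sum S (cls : T -> T) :
  (forall x y, x \notin S -> y \notin S -> e x y -> cls x = cls y) ->
  \sum_(k in odd_classes S cls) cut (class S cls k) = \sum_(y in S) nbr (odd_union S cls) y.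
Proof.
move=> Hc; rewrite -sum_nbrC.
rewrite [RHS](partition_big cls (mem (odd_classes S cls))) => [|x]; last by case/setIdP.
apply: eq_bigr => k kO; rewrite /cut; apply: congr_big => // x.
  rewrite [in RHS]inE [in LHS]inE -andbA; apply: andb_id2l => _.
  by apply/idP/andP => [/eqP->|[]].
rewrite inE => /andP[xS xk]; rewrite inE in xS; rewrite /nbr.
rewrite (big_setID S) /= [X in _ + X]big1 ?addn0 => [|y].
  apply: eq_bigl => y; rewrite !inE; case yS: (y \in S); rewrite ?andbF //.
rewrite !inE !negb_and negbK => /andP[yS]; rewrite (negbTE yS) /= => yk.
apply/eqP; rewrite eqb0; apply: contra yk => exy.
by rewrite -(Hc x y xS yS exy).
Qed.

Lemma odd_class_neq0 S cls k : k \in odd_classes S cls -> class S cls k != set0.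
Proof. by rewrite inE; apply: contraTneq; rewrite /class => ->; rewrite cards0. Qed.

(* A parity count shows that an odd set meets at least two edges of its cut. *)
Lemma bipartite_reg2_pm X : irreflexive e -> (forall x, nbr setT x = 2) ->
  (forall x y, e x y -> (x \in X) (+) (y \in X)) -> exists f, pm e f.
Proof.
move=> ei d2 bip.
have inner W : exists m, \sum_(x in W) nbr W x = m.*2.
  exists (\sum_(x in W :&: X) nbr (W :\: X) x).
  rewrite (big_setID X) /=.
  have E1 : \sum_(x in W :&: X) nbr W x = \sum_(x in W :&: X) nbr (W :\: X) x.
    apply: eq_bigr => x; rewrite inE => /andP[_ xX].
    rewrite /nbr (big_setID X) /= big1 // => y; rewrite inE => /andP[_ yX].
    by apply/eqP; rewrite eqb0; apply/negP => /bip; rewrite xX yX.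
  have E2 : \sum_(x in W :\: X) nbr W x = \sum_(x in W :\: X) nbr (W :&: X) x.
    apply: eq_bigr => x; rewrite inE => /andP[xX _].
    rewrite /nbr (big_setID X) /= addnC big1 // => y; rewrite inE => /andP[yX _].
    by apply/eqP; rewrite eqb0; apply/negP => /bip; rewrite (negbTE xX) (negbTE yX).
  by rewrite E1 E2 [in X in _ + X]sum_nbrC addnn.
(* In a set that no edge leaves, the two sides of the bipartition meet the same edges, two per
   vertex, and so have equal size. *)
have bal W : cut W = 0 -> ~~ odd #|W|.
  move=> cW.
  have cl x y : x \in W -> e x y -> y \in W.
    move=> xW exy; apply: contraTT exy => yW.
    move/eqP: cW; rewrite sum_nat_eq0 => /forallP/(_ x)/implyP/(_ xW)/eqP/nbr_eq0->//.
    by rewrite inE.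
  have D1 : \sum_(x in W :&: X) nbr (W :\: X) x = #|W :&: X| * 2.
    rewrite -sum_nat_const; apply: eq_bigr => x; rewrite inE => /andP[xW xX].
    rewrite -(d2 x); apply: nbr_sub_full => y exy; rewrite inE (cl x y) // andbT.
    by apply/negP => yX; have := bip x y exy; rewrite xX yX.
  have D2 : \sum_(x in W :\: X) nbr (W :&: X) x = #|W :\: X| * 2.
    rewrite -sum_nat_const; apply: eq_bigr => x; rewrite inE => /andP[xX xW].
    rewrite -(d2 x); apply: nbr_sub_full => y exy; rewrite inE (cl x y) //=.
    by apply: contraT => yX; have := bip x y exy; rewrite (negbTE xX) (negbTE yX).
  by rewrite -(cardsID X W); move: D1; rewrite sum_nbrC D2; lia.
have cutT : cut setT = 0.
  by rewrite /cut big1 // => x _; rewrite nbr0 // => y; rewrite !inE.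
have ev : ~~ odd #|T| by rewrite -cardsT bal.
have cut2 W : odd #|W| -> 2 <= cut W.
  move=> oW; have [m Hm] := inner W.
  have : cut W + m.*2 = #|W| * 2.
    rewrite -Hm /cut -big_split /= -sum_nat_const; apply: eq_bigr => x _.
    by rewrite addnC nbr_setC.
  have : cut W <> 0 by move=> /bal; rewrite oW.
  lia.
have [//|[S [cls [Hc Ho]]]] := tutte es ei ev.
have := odd_cut_sum Hc => E.
(* Each odd class sends at least two edges to [S], and [S] receives at most two per vertex, which
   contradicts the surplus of odd classes. *)
have : \sum_(k in odd_classes S cls) 2 <= \sum_(y in S) nbr (odd_union S cls) y.
  by rewrite -E; apply: leq_sum => k; rewrite inE => /cut2.
have : \sum_(y in S) nbr (odd_union S cls) y <= \sum_(y in S) 2.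
  by apply: leq_sum => y _; rewrite -(d2 y) nbrS ?subsetT.
rewrite !sum_nat_const; lia.
Qed.
End Neighbours.

(** * Tutte's theorem inside a vertex subset, and its tight case around a hexagon *)

Section Subset.
Variables (V : finType) (e : rel V).
Hypothesis (es : symmetric e) (ei : irreflexive e).

(** [tutte] for the subgraph induced on [A], restated on [V]: the classes avoid [S :|: ~: A], but
    only [S] is counted in the barrier. *)
Lemma tutte_on (A : {set V}) : ~~ odd #|A| ->
  (exists f, involutive f /\ forall x, x \in A -> f x \in A /\ e x (f x)) \/
  exists (S : {set V}) (cls : V -> V), [/\ S \subset A,
    forall x y, x \notin S :|: ~: A -> y \notin S :|: ~: A -> e x y -> cls x = cls y &
    #|S| + 2 <= #|odd_classes (S :|: ~: A) cls|].
Proof.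
move=> evA; pose T := {x : V | x \in A}.
have evT : ~~ odd #|{: T}| by rewrite card_sig.
have sT : symmetric (relpre val e : rel T) by move=> x y; apply: es.
have iT : irreflexive (relpre val e : rel T) by move=> x; apply: ei.
have [[f [fK fe]]|] := tutte sT iT evT.
  left.
  pose g x := if insub x is Some u then val (f u) else x.
  have gE (u : T) : g (val u) = val (f u) by rewrite /g valK.
  exists g; split=> [x|x xA].
    have [xA|xA] := boolP (x \in A); first by rewrite -[x]/(val (Sub x xA : T)) !gE fK.
    by rewrite /g !insubN.
  by rewrite -[x]/(val (Sub x xA : T)) gE (valP (f _)); split=> //; exact: fe.
move=> [S [cls [Hc Ho]]]; right.
pose g x := if insub x is Some u then val (cls u) else x.
have gE (u : T) : g (val u) = val (cls u) by rewrite /g valK.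
have notS x : x \notin [set val u | u in S] :|: ~: A -> exists2 u : T, x = val u & u \notin S.
  rewrite !inE negb_or negbK => /andP[xS xA]; exists (Sub x xA) => //.
  by apply: contra xS => uS; apply/imsetP; exists (Sub x xA).
exists [set val u | u in S], g; split.
- by apply/subsetP => _ /imsetP[u _ ->]; apply: valP.
- by move=> x y /notS[u -> uS] /notS[v -> vS] euv; rewrite !gE (Hc u v).
rewrite (card_imset _ val_inj) (leq_trans Ho) // -(card_imset _ val_inj).
apply: subset_leq_card; apply/subsetP => _ /imsetP[k kO ->]; move: kO; rewrite !inE.
congr (odd _); rewrite -(card_imset _ val_inj); apply: eq_card => x.
apply/imsetP/idP => [[u + ->]|].
  rewrite !inE => /andP[uS /eqP<-]; rewrite gE eqxx andbT negb_or (valP u) andbT.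
  by rewrite (mem_imset _ _ val_inj).
rewrite !inE => /andP[xS].
have [u -> uS] : exists2 u : T, x = val u & u \notin S by apply: notS; rewrite !inE.
by rewrite gE (inj_eq val_inj) => E; exists u; rewrite // !inE uS.
Qed.

Hypothesis deg3 : forall x, nbr e setT x = 3.
Hypothesis cut3 : forall W : {set V}, W != set0 -> ~: W != set0 ->
  3 <= cut e W /\ (cut e W <= 3 -> (#|W| <= 1) || (#|~: W| <= 1)).

(** The Tutte obstruction is tight. Each odd class sends at least three edges to [S :|: C]; [S]
    receives at most three per vertex, and each of the six vertices of [C], having two neighbours in
    [C], at most one. Thus [3 * (#|S| + 2) <= 3 * #|S| + 6] holds with equality throughout: odd
    classes are single vertices, and all edges leaving [S] or [C] go to them. *)
Lemma pm_or_bipartite (C : {set V}) : ~~ odd #|~: C| -> #|C| = 6 ->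
  (forall x, x \in C -> 2 <= nbr e C x) ->
  (exists f, involutive f /\ forall x, x \in ~: C -> f x \in ~: C /\ e x (f x)) \/
  exists S T : {set V}, [/\ [/\ ~: C = S :|: T, [disjoint S & T] & #|T| = #|S| + 2],
    forall x y, x \in S -> e x y -> y \in T,
    forall x y, x \in T -> e x y -> y \in S :|: C &
    forall x, x \in C -> nbr e C x = 2 /\ nbr e T x = 1].
Proof.
move=> evA C6 C2; have [f|[S [cls [SC Hc Ho]]]] := tutte_on evA; [by left|right].
rewrite setCK in Hc Ho.
set B := S :|: C in Hc Ho; set O := odd_classes B cls in Ho; pose T := odd_union B cls.
have dSC : [disjoint S & C] by rewrite disjoints_subset.
have classC k : C \subset ~: class B cls k.
  by apply/subsetP => x xC; rewrite !inE xC !orbT.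
(* The complement of a class contains the six vertices of [C], so with a cut of three edges it is
   the class that is a single vertex. *)
have c1 k : k \in O -> 3 <= cut e (class B cls k) /\
    (cut e (class B cls k) <= 3 -> #|class B cls k| <= 1).
  move=> kO; have cC := subset_leq_card (classC k); rewrite C6 in cC.
  have nk : ~: class B cls k != set0 by rewrite -card_gt0; lia.
  have [c3 H] := cut3 (odd_class_neq0 kO) nk.
  by split=> // /H; lia.
have TB : [disjoint T & C].
  by rewrite disjoint_sym disjoints_subset; apply/subsetP => x xC; rewrite !inE xC orbT.
have SBT : [disjoint S & T].
  by rewrite disjoints_subset; apply/subsetP => x xS; rewrite !inE xS.
have nT x : x \in C -> nbr e T x <= 1.
  move=> xC; have := C2 x xC; have : nbr e (C :|: T) x <= 3 by rewrite -(deg3 x) nbrS ?subsetT.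
  by rewrite nbrU 1?disjoint_sym //; lia.
have E := odd_cut_sum es Hc; rewrite -/O -/T in E.
have L1 : #|O| * 3 <= \sum_(k in O) cut e (class B cls k).
  by rewrite -sum_nat_const; apply: leq_sum => k /c1[].
have EB : \sum_(y in B) nbr e T y = \sum_(y in S) nbr e T y + \sum_(y in C) nbr e T y.
  by rewrite /B sum_setU.
have LS : \sum_(y in S) nbr e T y <= \sum_(y in S) 3.
  by apply: leq_sum => y _; rewrite -(deg3 y) nbrS ?subsetT.
have LC : \sum_(y in C) nbr e T y <= \sum_(y in C) 1 by apply: leq_sum.
have [oS oC oO] : [/\ #|O| = #|S| + 2,
    \sum_(y in S) nbr e T y = \sum_(y in S) 3 /\ \sum_(y in C) nbr e T y = \sum_(y in C) 1 &
    \sum_(k in O) cut e (class B cls k) = \sum_(k in O) 3].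
  by move: L1 LS LC Ho; rewrite E EB !sum_nat_const C6 => *; split; [lia|split; lia|lia].
have sumE (I : finType) (P : {set I}) (F G : I -> nat) : (forall i, i \in P -> F i <= G i) ->
    \sum_(i in P) F i = \sum_(i in P) G i -> forall i, i \in P -> F i = G i.
  move=> le eqs i iP; apply/eqP; rewrite eqn_leq le //= leqNgt; apply/negP => lt.
  have : \sum_(i in P) F i < \sum_(i in P) G i.
    rewrite (bigD1 i) // [X in _ < X](bigD1 i) //= -addSn leq_add //.
    by apply: leq_sum => j /andP[/le].
  by rewrite eqs ltnn.
have nS x : x \in S -> nbr e T x = 3.
  by apply: (sumE _ _ _ (fun=> 3)) => [y _|]; [rewrite -(deg3 y) nbrS ?subsetT|case: oC].
have nC x : x \in C -> nbr e T x = 1.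
  by apply: (sumE _ _ _ (fun=> 1)) => [y|]; [exact: nT|case: oC].
have single k : k \in O -> #|class B cls k| = 1.
  move=> kO; have [_ H] := c1 k kO; apply/eqP; rewrite eqn_leq card_gt0 odd_class_neq0 // andbT H //.
  have /= <- // := sumE _ O (fun=> 3) (fun k => cut e (class B cls k))
    (fun i iO => (c1 i iO).1) (esym oO) k kO.
have cardT : #|T| = #|S| + 2.
  rewrite -oS -sum1_card (partition_big cls (mem O)) /= => [|x]; last by rewrite inE => /andP[].
  rewrite -[RHS]sum1_card; apply: eq_bigr => k kO; transitivity #|class B cls k|; last exact: single.
  rewrite -sum1_card.
  apply: eq_bigl => x; rewrite !inE -andbA; apply: andb_id2l => _.
  by apply/andP/idP => [[]//|/eqP E']; rewrite E' eqxx; split=> //; move: kO; rewrite inE.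
have ST x y : x \in S -> e x y -> y \in T.
  by move=> xS; apply: nbr_full; rewrite deg3 nS.
have CT x y : x \in C -> e x y -> y \in C :|: T.
  move=> xC; apply: nbr_full; rewrite deg3 nbrU 1?disjoint_sym // nC //.
  by have := C2 x xC; lia.
have clsT x y : x \in T -> y \notin B -> e x y -> y \in T.
  by rewrite inE => /andP[xB xO] yB exy; rewrite inE inE yB -(Hc x y) // -in_setC.
(* The vertices left over, those of even classes, have no edge to the rest, whereas a proper
   nonempty set has at least three cut edges. *)
have Z0 : ~: (B :|: T) = set0.
  apply/eqP; apply: contraT => Z0.
  have Z1 : ~: ~: (B :|: T) != set0.
    by rewrite setCK -card_gt0; have := subset_leq_card (subsetUr S C);
       have := subset_leq_card (subsetUl B T); rewrite -/B; lia.
  have [+ _] := cut3 Z0 Z1; rewrite /cut big1 // => x; rewrite inE => xZ.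
  apply: nbr0 => y; rewrite setCK => yBT; apply: contra xZ => exy.
  rewrite es in exy; move: yBT; rewrite !inE -orbA => /or3P[yS|yC|yT].
  - by have := ST _ _ yS exy; rewrite !inE => ->; rewrite orbT.
  - by have := CT _ _ yC exy; rewrite !inE => /orP[->|->]; rewrite !orbT.
  have [xB|xB] := boolP (x \in B); first by move: xB; rewrite !inE => ->.
  have := clsT y x _ xB exy; rewrite !inE => H; rewrite H ?orbT //.
exists S, T; split=> //.
- split=> //; apply/setP => x.
  have : x \in B :|: T by rewrite -[B :|: T]setCK Z0 setC0 in_setT.
  rewrite in_setU [x \in B]in_setU in_setC in_setU => xBT.
  apply/idP/orP => [xC|[xS|xT]].
  - by move: xBT; rewrite (negbTE xC) orbF => /orP.
  - by rewrite -in_setC (subsetP SC).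
  by rewrite (disjointFr TB xT).
- move=> x y xT exy; rewrite -/B; apply: contraT => yB.
  have yT := clsT x y xT yB exy.
  have := xT; rewrite inE => /andP[xB xO]; have := yT; rewrite inE => /andP[_ yO].
  have /cards1P[z zE] : #|class B cls (cls x)| == 1 by apply/eqP/single.
  have xz : x \in [set z] by rewrite -zE inE xB eqxx.
  have yz : y \in [set z].
    by rewrite -zE inE inE yB /= -(Hc x y) // -in_setC.
  by move: exy; rewrite (set1P xz) (set1P yz) ei.
move=> x xC; split; last exact: nC.
have := C2 x xC; have : nbr e (C :|: T) x <= 3 by rewrite -(deg3 x) nbrS ?subsetT.
by rewrite nbrU 1?disjoint_sym // nC //; lia.
Qed.
End Subset.

(** * The complement of the hexagon when it has no perfect matching *)

Lemma path_all_target (T : Type) (r : rel T) (Q : pred T) x p :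
  path r x p -> all Q p -> path (fun y z => r y z && Q z) x p.
Proof. by elim: p x => //= y p IH x /andP[-> /IH H] /andP[-> /H]. Qed.

(** The consecutive entries of [l] are matched in pairs; off [l] the matching is [g]. *)
Definition pairing (T : eqType) (g : T -> T) (l : seq T) x :=
  if x \in l then nth x l (flip (index x l)) else g x.

Lemma pairingE (T : eqType) (g : T -> T) l x0 i : uniq l -> ~~ odd (size l) -> i < size l ->
  pairing g l (nth x0 l i) = nth x0 l (flip i).
Proof.
by move=> ul ol il; rewrite /pairing mem_nth // index_uniq //; apply: set_nth_default; apply: flip_lt.
Qed.

Lemma pairingK (T : eqType) (g : T -> T) l : uniq l -> ~~ odd (size l) -> involutive g ->
  (forall x, x \notin l -> g x \notin l) -> involutive (pairing g l).
Proof.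
move=> ul ol gK gl x; have [xl|xl] := boolP (x \in l).
  rewrite -(nth_index x xl); have il : index x l < size l by rewrite index_mem.
  by rewrite pairingE // pairingE ?flip_lt // flipK.
by rewrite /pairing (negbTE xl) (negbTE (gl x xl)) gK.
Qed.

Lemma perm_opposite8 (T : eqType) (a b c d p q r s : T) :
  perm_eq [:: a; b; c; d; p; q; r; s] [:: b; d; a; p; q; c; r; s].
Proof. by apply/permP => P /=; lia. Qed.

Lemma perm_petersen10 (T : eqType) (a b c d p q r s t u : T) :
  perm_eq [:: a; b; c; d; p; q; r; s; t; u] [:: c; d; t; r; u; s; b; p; q; a].
Proof. by apply/permP => P /=; lia. Qed.

Section Cubic.
Variables (V : finType) (e : rel V).
Hypothesis (es : symmetric e) (ei : irreflexive e).
Hypothesis deg3 : forall x, nbr e setT x = 3.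

Lemma nbr_card (X : {set V}) x : nbr e X x = #|[set y in X | e x y]|.
Proof.
rewrite /nbr -sum1_card big_mkcond [RHS]big_mkcond; apply: eq_bigr => y _.
by rewrite !inE; case: (y \in X); case: (e x y).
Qed.

Lemma nbr_exhaust (X : {set V}) x (l : seq V) y : uniq l -> (forall z, z \in l -> z \in X /\ e x z) ->
  nbr e X x = size l -> y \in X -> e x y -> y \in l.
Proof.
move=> ul H; rewrite nbr_card cardE => sz yX exy.
have [||_ ->] := uniq_min_size ul (s2 := enum [set y in X | e x y]).
- by move=> z /H[zX exz]; rewrite mem_enum inE zX.
- by rewrite sz.
by rewrite mem_enum inE yX.
Qed.

(** [f3 x] is the remaining neighbour of [x]. It is an involution because the edge back to [x]
    cannot be the one chosen by [f1] or [f2]. *)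
Lemma third_pm f1 f2 : pm e f1 -> pm e f2 -> (forall x, f1 x != f2 x) ->
  exists f3, pm e f3 /\ forall x y, e x y -> [|| y == f1 x, y == f2 x | y == f3 x].
Proof.
move=> [f1K f1e] [f2K f2e] f12.
pose N x := [set y | e x y] :\ f1 x :\ f2 x.
have cN x : #|N x| = 1.
  have : #|[set y | e x y]| = 3 by rewrite -(deg3 x) nbr_card; apply: eq_card => y; rewrite !inE.
  by rewrite (cardsD1 (f1 x)) inE f1e (cardsD1 (f2 x)) !inE eq_sym f12 f2e /N /=; lia.
pose f3 x := odflt x [pick y in N x].
have f3N x : N x = [set f3 x].
  have /eqP/cards1P[y Ny] := cN x; rewrite Ny /f3; congr [set _].
  by case: pickP => [z|/(_ y)]; rewrite Ny inE ?eqxx // => /eqP->.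
have f3P x y : e x y -> [|| y == f1 x, y == f2 x | y == f3 x].
  move=> exy; have : (y \in N x) = (y == f3 x) by rewrite f3N inE.
  by rewrite !inE exy andbT => <-; do 2!case: eqP.
have f3e x : [/\ e x (f3 x), f3 x != f1 x & f3 x != f2 x].
  have : f3 x \in N x by rewrite f3N inE.
  by rewrite !inE => /and3P[].
exists f3; split=> //; split=> x; last by case: (f3e x).
have [e3 n1 n2] := f3e x; rewrite es in e3.
case/or3P: (f3P _ _ e3) => /eqP E; last by rewrite -E.
  by rewrite {2}E f1K eqxx in n1.
by rewrite {2}E f2K eqxx in n2.
Qed.

(** * Alternating paths in the bipartite complement of the hexagon *)

Section Bipartite.
Variables S T C : {set V}.
Hypotheses (AST : ~: C = S :|: T) (dST : [disjoint S & T]) (cST : #|T| = #|S| + 2).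
Hypothesis NS : forall x y, x \in S -> e x y -> y \in T.
Hypothesis NT : forall x y, x \in T -> e x y -> y \in S :|: C.
Hypothesis NC : forall x, x \in C -> nbr e C x = 2 /\ nbr e T x = 1.

(** Only [S] has to be matched along edges. A vertex [t] of [T] with [f t] outside [S] counts as
    exposed, whatever its partner is. *)
Definition saturates (f : V -> V) := forall s, s \in S -> f s \in T /\ e s (f s).

Lemma pm_saturates f : pm e f -> saturates f.
Proof. by move=> [_ fe] s sS; split=> //; apply: NS (fe s). Qed.

Lemma exposed_card f : involutive f -> saturates f -> #|[set t in T | f t \notin S]| = 2.
Proof.
move=> fK fS; have E : [set t in T | f t \in S] = f @: S.
  apply/setP => t; rewrite inE; apply/andP/imsetP => [[_ ftS]|[s sS ->]].
    by exists (f t); rewrite ?fK.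
  by rewrite fK sS; have [] := fS s sS.
have := cardsID [set t | f t \in S] T; rewrite cST.
have -> : T :&: [set t | f t \in S] = f @: S by rewrite -E; apply/setP => t; rewrite !inE.
rewrite (card_imset _ (inv_inj fK)).
have -> : T :\: [set t | f t \in S] = [set t in T | f t \notin S].
  by apply/setP => t; rewrite !inE andbC.
lia.
Qed.

(** Two steps of an alternating path at once: from [t] by an edge to a vertex of [S], then to its
    partner [t']. *)
Definition alt_step (f : V -> V) : rel V :=
  fun t t' => [&& t' \in T, f t' \in S & e t (f t')].

(** Giving [t] the partner [f u] of the next vertex [u] exposes [u] in its place. The later steps
    stay valid since they meet neither [t] nor [u] again, and [t0], being off the path, stays
    exposed. *)
Lemma alternating_path f t0 t p : involutive f -> (forall x, f x != x) -> saturates f ->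
  t \in T -> f t \notin S -> t0 \in T -> f t0 \notin S -> t0 \notin t :: p ->
  uniq (t :: p) -> path (alt_step f) t p ->
  exists g, [/\ involutive g, saturates g, g t0 \notin S & g (last t p) \notin S].
Proof.
elim: p f t => [|u p IH] f t fK fN fS tT ftS t0T ft0S t0p up /=; first by exists f.
case/andP=> /and3P[uT fuS etfu] pp.
have TS x : x \in T -> x \notin S by move=> xT; rewrite (disjointFl dST xT).
have neST x y : x \in S -> y \in T -> x != y.
  by move=> xS yT; apply: contraTneq xS => ->; apply: TS.
set s := f u in fuS etfu; have fs : f s = u by rewrite fK.
have st : s != t by exact: neST.
have sft : s != f t by apply: contraNneq ftS => <-.
have [gK gN] := repair_invol fK fN st sft.
have g1 : repair f t s t = s by exact: repairE1.
have g2 : repair f t s s = t by exact: repairE2.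
have g3 : repair f t s (f t) = u by rewrite repairE3.
have g4 : repair f t s u = f t by rewrite -fs repairE4.
have gE x : x != t -> x != s -> x != f t -> x != u -> repair f t s x = f x.
  by move=> *; rewrite repairE // fs.
have t0u : t0 != u by move: t0p; rewrite !inE !negb_or => /and3P[].
have t0t : t0 != t by move: t0p; rewrite !inE !negb_or => /and3P[].
apply: (IH (repair f t s) u) => //.
- move=> x xS; have [->|xs] := eqVneq x s; first by rewrite g2 es.
  rewrite gE //; first exact: fS.
  + exact: neST.
  + by apply: contraNneq ftS => <-.
  exact: neST.
- by rewrite g4.
- have [->|xft] := eqVneq t0 (f t); first by rewrite g3 TS.
  by rewrite gE //; apply: contraNneq (TS _ t0T) => ->.
- by move: t0p; rewrite !inE !negb_or => /and3P[_ -> ->].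
- by case/andP: up.
case/andP: up => tp /andP[pu _].
have : all (fun y => (y != u) && (y != t)) p.
  apply/allP => y yp; apply/andP; split; first by apply: contraNneq pu => <-.
  by apply: contraNneq tp => <-; rewrite inE yp orbT.
move/(path_all_target pp); apply: sub_path => x y /andP[/and3P[yT fyS exy] /andP[yu yt]].
have E : repair f t s y = f y.
  apply: gE => //; first by rewrite eq_sym neST.
  by apply: contraTneq fyS => ->; rewrite fK TS.
by rewrite /alt_step E yT fyS.
Qed.

Hypothesis cut3 : forall W : {set V}, W != set0 -> ~: W != set0 ->
  3 <= cut e W /\ (cut e W <= 3 -> (#|W| <= 1) || (#|~: W| <= 1)).

(* If [t3] were not reachable, the unreachable vertices of [T] and the vertices
   of [S] not matched to reachable ones would form a nontrivial 3-edge cut. *)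
Lemma saturate_but f t0 t3 : 1 < #|C| -> pm e f -> t0 \in T -> f t0 \in C -> t3 \in T ->
  t0 != t3 ->
  exists g, [/\ involutive g, saturates g, g t0 \notin S & g t3 \notin S].
Proof.
move=> C2 fpm t0T ft0C t3T t03; have [fK fe] := fpm; have fS := pm_saturates fpm.
have fN x : f x != x by apply: contraTneq (fe x) => ->; rewrite ei.
have TS x : x \in T -> x \notin S by move=> xT; rewrite (disjointFl dST xT).
have CS x : x \in C -> x \notin S :|: T by rewrite -AST inE negbK.
have ft0S : f t0 \notin S by have := CS _ ft0C; rewrite inE => /norP[].
have /eqP/cards2P[a [b [ab Dab]]] := exposed_card fK fS.
have [t [tt0 tD D]] : exists t, [/\ t0 != t, t \in T & f t \notin S /\
    forall x, x \in T -> f x \notin S -> x = t0 \/ x = t].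
  have: t0 \in [set a; b] by rewrite -Dab inE t0T.
  have Da : a \in [set a; b] by rewrite !inE eqxx.
  have Db : b \in [set a; b] by rewrite !inE eqxx orbT.
  have H x : x \in T -> f x \notin S -> x = a \/ x = b.
    by move=> xT fxS; have : x \in [set a; b] by [rewrite -Dab inE xT]; rewrite !inE => /orP[]/eqP; auto.
  move: Da Db; rewrite -Dab !inE => /andP[aT faS] /andP[bT fbS].
  rewrite t0T ft0S => _; have [E|E] := H t0 t0T ft0S; subst t0.
    by exists b.
  exists a; rewrite eq_sym; split=> //; split=> // x xT fxS.
  by have [] := H x xT fxS; auto.
have [ftS D'] := D.
(* The vertices of [T] to which the exposure of [t] can be moved. *)
pose R := [set y | connect (alt_step f) t y].
have [t3R|t3R] := boolP (t3 \in R).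
  move: t3R; rewrite inE => /connectP[p pp ->]; case: (shortenP pp) => q pq uq _.
  apply: (alternating_path fK fN fS) => //.
  rewrite inE (negbTE tt0) /=; apply: contra ft0S => t0q.
  case/splitPr: t0q pq {uq} => q1 q2; rewrite cat_path /= => /and3P[_ /and3P[]] //.
have tR : t \in R by rewrite inE connect0.
have t0R : t0 \notin R.
  rewrite inE; apply: contra ft0S => /connectP[p]; case/lastP: p => [_ /= E|p y].
    by rewrite E eqxx in tt0.
  by rewrite rcons_path last_rcons => /andP[_ /and3P[_ ? _]] ->.
have Rcl x y : x \in R -> y \in S -> e x y -> f y \in R.
  rewrite !inE => xR yS exy; apply: connect_trans xR (connect1 _).
  by rewrite /alt_step fK yS exy; have [-> _] := fS y yS.
clearbody R; pose X := [set s in S | f s \notin R]; pose Y := T :\: R; pose W := X :|: Y.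
have dXY : [disjoint X & Y].
  by apply: disjointWl (disjointWr _ dST); [apply/subsetP => x; rewrite inE => /andP[]|exact: subsetDl].
(* Among the unreachable vertices of [T] only [t0] is exposed; the others are exactly the partners
   of [X]. *)
have cXY : #|Y| = #|X| + 1.
  have -> : Y = t0 |: f @: X.
    apply/setP => y; rewrite !inE; apply/andP/orP => [[yR yT]|[/eqP->//|/imsetP[s + ->]]].
      have [fyS|fyS] := boolP (f y \in S).
        by right; apply/imsetP; exists (f y); rewrite ?inE ?fyS fK.
      by have [->|E] := D' y yT fyS; [left|rewrite E tR in yR].
    by rewrite inE => /andP[sS ->]; have [-> _] := fS s sS.
  rewrite cardsU1 (card_imset _ (inv_inj fK)) addnC; congr (_ + _).
  suff -> : t0 \notin f @: X by [].
  by apply: contra ft0S => /imsetP[s + ->]; rewrite inE fK => /andP[].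
have NX x y : x \in X -> e x y -> y \in Y.
  rewrite !inE => /andP[xS fxR] exy; rewrite (NS xS exy) andbT.
  by apply: contra fxR => yR; apply: Rcl yR xS _; rewrite es.
(* [X] sends all its edges to [Y], and [Y] has no inner edges, so the cut of [W] is three times the
   difference [#|Y| - #|X|]. *)
have cutW : cut e W = 3.
  rewrite /cut sum_setU // [X in X + _]big1 => [|x xX]; last first.
    by apply: nbr0 => y; rewrite inE; apply: contra => /(NX x y xX) yY; rewrite inE yY orbT.
  have : \sum_(y in Y) nbr e (~: W) y + \sum_(y in Y) nbr e X y = #|Y| * 3.
    rewrite -sum_nat_const -big_split /=; apply: eq_bigr => y yY.
    rewrite -(deg3 y) -(nbr_setC e W) addnC; congr (_ + _); rewrite nbrU // (@nbr0 _ e Y) ?addn0 //.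
    move=> z zY; apply/negP; move: zY yY; rewrite !inE => /andP[_ zT] /andP[_ yT] /(NT yT).
    rewrite inE (negbTE (TS _ zT)) /= => zC.
    by have := CS z zC; rewrite inE zT orbT.
  have -> : \sum_(y in Y) nbr e X y = #|X| * 3.
    rewrite (sum_nbrC es) -sum_nat_const; apply: eq_bigr => x xX.
    by rewrite -(deg3 x); apply: nbr_sub_full => y; apply: NX.
  by rewrite cXY mulnDl [X in X = _ -> _]addnC => /addnI.
have sub1 : [set t0; t3] \subset W.
  by apply/subsetP => x; rewrite !inE => /orP[]/eqP->; rewrite ?t0R ?t0T ?t3R ?t3T ?orbT.
have sub2 : C \subset ~: W.
  apply/subsetP => x /CS; rewrite !inE !negb_or !negb_and => /andP[-> ->].
  by rewrite orbT.
have := subset_leq_card sub1; rewrite cards2 t03 => c1.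
have c2 := leq_trans C2 (subset_leq_card sub2).
have W0 : W != set0 by rewrite -card_gt0 (leq_trans _ c1).
have W1 : ~: W != set0 by rewrite -card_gt0 (leq_trans _ c2).
by have [_] := cut3 W0 W1; rewrite cutW => /(_ isT)/orP[]; rewrite leqNgt ?c1 ?c2.
Qed.

(** Disjointness need not be demanded: in a cubic graph three perfect matchings covering all edges
    are disjoint, hence form a 3-edge-colouring. *)
Definition colourable := exists f1 f2 f3, [/\ pm e f1, pm e f2, pm e f3 &
  forall x y, e x y -> [|| y == f1 x, y == f2 x | y == f3 x]].

(* The perfect matching through [v0 t0], [v3 t3], [v1 v2], [v4 v5] leaves a
   2-factor which is bipartite with one side [T] together with [v0] and [v3]. *)
Lemma opposite_outer v0 v1 v2 v3 v4 v5 f t3 :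
  ~ colourable -> C =i [:: v0; v1; v2; v3; v4; v5] -> uniq [:: v0; v1; v2; v3; v4; v5] ->
  [/\ e v0 v1, e v1 v2, e v2 v3 & [/\ e v3 v4, e v4 v5 & e v5 v0]] ->
  pm e f -> f v0 \in T -> t3 \in T -> e v3 t3 -> f v0 = t3.
Proof.
move=> ncol CE uv [e01 e12 e23 [e34 e45 e50]] fpm t0T t3T e3; have [fK fe] := fpm.
have e0 := fe v0; move: e0 t0T; set t0 := f v0 => e0 t0T.
apply/eqP; apply: contraT => t03; case: ncol.
have vC i : i < 6 -> nth v0 [:: v0; v1; v2; v3; v4; v5] i \in C.
  by move=> i6; rewrite CE mem_nth.
have [v0C v1C v2C] : [/\ v0 \in C, v1 \in C & v2 \in C] by split; [exact: (vC 0)|exact: (vC 1)|exact: (vC 2)].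
have [v3C v4C v5C] : [/\ v3 \in C, v4 \in C & v5 \in C] by split; [exact: (vC 3)|exact: (vC 4)|exact: (vC 5)].
have C2 : 1 < #|C| by rewrite (eq_card CE) (card_uniqP uv).
have ft0C : f t0 \in C by rewrite /t0 fK.
have [g [gK gS gt0 gt3]] := saturate_but C2 fpm t0T ft0C t3T t03.
have CS x : x \in C -> x \notin S :|: T by rewrite -AST inE negbK.
have CnS x : x \in C -> x \in S = false by move/CS; rewrite inE => /norP[/negbTE].
have CnT x : x \in C -> x \in T = false by move/CS; rewrite inE => /norP[_ /negbTE].
have TnS x : x \in T -> x \in S = false by move=> xT; rewrite (disjointFl dST xT).
have gT x : x \in T -> x != t0 -> x != t3 -> g x \in S.
  move=> xT x0 x3; apply: contraT => gxS.
  have : [set t0; t3] == [set t in T | g t \notin S].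
    rewrite eqEcard (exposed_card gK gS) cards2 t03 andbT.
    by apply/subsetP => y; rewrite !inE => /orP[]/eqP->; rewrite ?t0T ?t3T.
  by move/eqP/setP/(_ x); rewrite !inE (negbTE x0) (negbTE x3) xT gxS.
(* The order matters: the consecutive pairs of [L] become edges of the new matching, which follows
   [g] elsewhere. *)
pose L := [:: v0; t0; v3; t3; v1; v2; v4; v5].
have uL : uniq L.
  have perm : perm_eq L ([:: t0; t3] ++ [:: v0; v1; v2; v3; v4; v5]) by apply: perm_opposite8.
  rewrite (perm_uniq perm) cat_uniq uv andbT; apply/andP; split; first by rewrite /= inE t03.
  by apply/hasPn => x; rewrite -CE => xC; rewrite !inE; apply/norP; split;
    apply: contraTneq xC => ->; apply/negP => /CnT; rewrite ?t0T ?t3T.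
have notL x : x \notin L -> (x \in S) || [&& x \in T, x != t0 & x != t3].
  move=> xL; have xC : x \notin C.
    rewrite CE; apply: contra xL; rewrite !inE.
    by do 6!(case: eqP => _; rewrite ?orbT //).
  have : x \in S :|: T by rewrite -AST inE.
  rewrite inE => /orP[->//|xT]; rewrite xT /=.
  by move: xL; rewrite !inE !negb_or => /and5P[_ -> _ -> _]; rewrite orbT.
have LCt x : x \in L -> (x \in C) || (x \in [:: t0; t3]).
  have /allP/(_ x)// : all (fun x => (x \in C) || (x \in [:: t0; t3])) L.
  by rewrite /= v0C v1C v2C v3C v4C v5C !inE !eqxx !orbT.
have LS x : x \in S -> x \notin L.
  move=> xS; apply: contraTN xS => /LCt/orP[/CnS->//|].
  by rewrite !inE => /orP[]/eqP->; rewrite TnS.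
have LT x : x \in T -> x != t0 -> x != t3 -> x \notin L.
  move=> xT x0 x3; apply: contraTN xT => /LCt/orP[/CnT->//|].
  by rewrite !inE (negbTE x0) (negbTE x3).
have gL x : x \notin L -> g x \notin L.
  move=> /notL/orP[xS|/and3P[xT x0 x3]]; last by apply: LS; apply: gT.
  have [gxT _] := gS x xS; apply: LT => //.
    by apply: contraNneq gt0 => <-; rewrite gK.
  by apply: contraNneq gt3 => <-; rewrite gK.
pose n := pairing g L.
have nK : involutive n by apply: pairingK.
have nE i : i < 8 -> n (nth v0 L i) = nth v0 L (flip i) by move=> i8; apply: pairingE.
have ne x : e x (n x).
  have [xL|xL] := boolP (x \in L).
    rewrite -(nth_index v0 xL) nE; last by rewrite -index_mem in xL.
    have : index x L < 8 by rewrite -index_mem in xL.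
    move: (index x L) => i; do 8!(case: i => [|i]; first by rewrite /= // es).
    by [].
  rewrite /n /pairing (negbTE xL); case/orP: (notL x xL) => [/gS[]//|/and3P[xT x0 x3]].
  by have [_] := gS _ (gT x xT x0 x3); rewrite gK es.
have [n0 n3 n1 n2] : [/\ n v0 = t0, n v3 = t3, n v1 = v2 & n v2 = v1].
  by split; [exact: (nE 0)|exact: (nE 2)|exact: (nE 4)|exact: (nE 5)].
have [n4 n5] : n v4 = v5 /\ n v5 = v4 by split; [exact: (nE 6)|exact: (nE 7)].
pose e' : rel V := fun x y => e x y && (n x != y).
have es' : symmetric e'.
  by move=> x y; rewrite /e' es -(inj_eq (inv_inj nK)) nK eq_sym.
have ei' : irreflexive e' by move=> x; rewrite /e' ei.
have d2 x : nbr e' setT x = 2.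
  have := deg3 x; rewrite /nbr (bigD1 (n x)) ?inE //= ne /= [X in _ = X -> _]/= => H.
  rewrite (bigD1 (n x)) ?inE //= /e' eqxx andbF add0n; move/(congr1 predn): H => /= <-.
  by apply: eq_bigr => y /andP[_ yn]; rewrite eq_sym yn andbT.
have nbC x a b y : x \in C -> a \in C -> b \in C -> e x a -> e x b -> a != b ->
    y \in C -> e x y -> (y == a) || (y == b).
  move=> xC aC bC xa xb ab yC xy; have [cC _] := NC xC.
  have := @nbr_exhaust C x [:: a; b] y; rewrite /= !inE ab; apply=> // z.
  by rewrite !inE => /orP[]/eqP->.
have nbT x t y : x \in C -> t \in T -> y \in T -> e x t -> e x y -> y = t.
  move=> xC tT yT xt xy; have [_ cT] := NC xC.
  by apply/eqP; have := @nbr_exhaust T x [:: t] y; rewrite inE; apply => // z; rewrite inE => /eqP->.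
pose X := [set v0; v3] :|: T.
have CT x y : x \in C -> e x y -> (y \in T) || (y \in C).
  move=> xC xy; have : y \notin S.
    by apply/negP => yS; rewrite es in xy; have := NS yS xy; rewrite CnT.
  case yC: (y \in C); rewrite ?orbT // => yS; have : y \in ~: C by rewrite inE yC.
  by rewrite AST inE (negbTE yS) orbF.
have hex x a b y : x \in C -> a \in C -> b \in C -> e x a -> e x b -> a != b ->
    e x y -> [|| y \in T, y == a | y == b].
  move=> xC aC bC xa xb ab xy; case/orP: (CT x y xC xy) => [->//|yC].
  by rewrite (nbC x a b y) ?orbT.
have XE z : z \in C -> (z \in X) = (z == v0) || (z == v3).
  by move=> zC; rewrite in_setU CnT // orbF in_set2.
move: uv; rewrite /= !inE !negb_or => /and5P[/and5P[d01 d02 d03 d04 d05]].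
move=> /and4P[d12 d13 d14 d15] /and3P[d23 d24 d25] /andP[d34 d35] /andP[d45 _].
have [nX1 nX2 nX4 nX5] : [/\ v1 \notin X, v2 \notin X, v4 \notin X & v5 \notin X].
  by rewrite !XE // !negb_or ![_ == v0]eq_sym d01 d02 d04 d05 ![_ == v3]eq_sym d34 d35 ![v3 == _]eq_sym d13 d23.
have X0 : v0 \in X by rewrite XE ?eqxx.
have X3 : v3 \in X by rewrite XE ?eqxx ?orbT.
have [e10 e05 e32] : [/\ e v1 v0, e v0 v5 & e v3 v2] by split; rewrite es.
have [e21 e43 e54] : [/\ e v2 v1, e v4 v3 & e v5 v4] by split; rewrite es.
(* The only edges with both ends on one side are [v0 t0] and [v3 t3] inside [X], and [v1 v2] and
   [v4 v5] outside it; all four belong to [n]. *)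
have bip1 x y : x \in X -> e' x y -> y \notin X.
  rewrite in_setU in_set2 => + /andP[exy nxy]; case/orP=> [/orP[]/eqP xE|xT].
  - subst x; case/or3P: (hex v0 v1 v5 y v0C v1C v5C e01 e05 d15 exy) => [yT|/eqP->|/eqP->] //.
    by rewrite n0 (nbT v0 t0 y) ?eqxx in nxy.
  - subst x; case/or3P: (hex v3 v2 v4 y v3C v2C v4C e32 e34 d24 exy) => [yT|/eqP->|/eqP->] //.
    by rewrite n3 (nbT v3 t3 y) ?eqxx in nxy.
  have := NT xT exy; rewrite in_setU => /orP[yS|yC].
    by rewrite in_setU (disjointFr dST yS) in_set2 orbF; apply/norP; split;
      apply: contraTneq yS => ->; rewrite CnS.
  rewrite XE //; rewrite es in exy; apply/norP; split; apply: contraNneq nxy => yE; subst y.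
    by rewrite (nbT v0 t0 x) // -n0 nK.
  by rewrite (nbT v3 t3 x) // -n3 nK.
have bip2 x y : x \notin X -> e' x y -> y \in X.
  move=> xX /andP[exy nxy]; have TX z : z \in T -> z \in X by rewrite in_setU => ->; rewrite orbT.
  have [xC|xC] := boolP (x \in C); last first.
    have : x \in S :|: T by rewrite -AST inE.
    by rewrite inE => /orP[xS|/TX]; [apply: TX; apply: NS exy|rewrite (negbTE xX)].
  have K a b : a \in C -> b \in C -> e x a -> e x b -> a != b -> a \in X -> n x = b -> y \in X.
    move=> aC bC xa xb ab aX nb.
    case/or3P: (hex x a b y xC aC bC xa xb ab exy) => [/TX//|/eqP->//|/eqP yb].
    by rewrite nb yb eqxx in nxy.
  have : x \in [:: v0; v1; v2; v3; v4; v5] by rewrite -CE.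
  rewrite ![x \in _ :: _]inE => /or4P[|||/or3P[]] /eqP xE; subst x.
  - by rewrite X0 in xX.
  - by apply: (K v0 v2).
  - by apply: (K v3 v1) => //; rewrite eq_sym.
  - by rewrite X3 in xX.
  - by apply: (K v3 v5).
  by apply: (K v0 v4).
have [|f2 [f2K f2e]] := @bipartite_reg2_pm _ e' es' X ei' d2.
  move=> x y exy; have eyx : e' y x by rewrite es'.
  have [xX|xX] := boolP (x \in X); first by rewrite (negbTE (bip1 x y xX exy)).
  by rewrite (bip2 x y xX exy).
have f2n x : n x != f2 x by have /andP[] := f2e x.
have f2pm : pm e f2 by split=> // x; have /andP[] := f2e x.
have [f3 [f3pm cov]] := third_pm (conj nK ne) f2pm f2n.
by exists n, f2, f3.
Qed.

Lemma no_four_nbrs x a b c d : uniq [:: a; b; c; d] ->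
  e x a -> e x b -> e x c -> e x d -> False.
Proof.
move=> u xa xb xc xd; have := @nbr_exhaust setT x [:: a; b; c] d.
rewrite deg3 inE xd => H; have : d \in [:: a; b; c].
  apply: H => //; last by move=> z; rewrite !inE => /or3P[]/eqP->.
  by move: u; rewrite -[_ :: _]/([:: a; b; c] ++ [:: d]) cat_uniq => /andP[].
by move: u; rewrite -[_ :: _]/(rcons [:: a; b; c] d) rcons_uniq => /andP[/negbTE->].
Qed.

(** Only the presence of the fifteen edges is asked for; that there are no others follows later from
    the degrees. *)
Definition petersen_labelling (l : seq V) := [/\ uniq l, size l = 10, forall x, x \in l &
  forall x0, all (fun p => e (nth x0 l p.1) (nth x0 l p.2)) petersen_list].

(** [opposite_outer] is applied to the hexagon and to two rotations of it, one for each opposite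
    pair. The three common neighbours are distinct, since a coincidence would give a vertex four
    neighbours, and each has at most one edge left. As [#|T| = #|S| + 2], some vertex of [S]
    remains, and it must be all that lies outside. *)
Lemma petersen_of_bipartite v0 v1 v2 v3 v4 v5 :
  ~ colourable -> C =i [:: v0; v1; v2; v3; v4; v5] -> uniq [:: v0; v1; v2; v3; v4; v5] ->
  [/\ e v0 v1, e v1 v2, e v2 v3 & [/\ e v3 v4, e v4 v5 & e v5 v0]] ->
  (forall x, x \in C -> exists f, pm e f /\ f x \in T) ->
  exists l, petersen_labelling l.
Proof.
move=> ncol CE uv [e01 e12 e23 [e34 e45 e50]] Cpm.
have vC i : i < 6 -> nth v0 [:: v0; v1; v2; v3; v4; v5] i \in C.
  by move=> i6; rewrite CE mem_nth.
have [v0C v1C v2C] : [/\ v0 \in C, v1 \in C & v2 \in C] by split; [exact: (vC 0)|exact: (vC 1)|exact: (vC 2)].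
have [v3C v4C v5C] : [/\ v3 \in C, v4 \in C & v5 \in C] by split; [exact: (vC 3)|exact: (vC 4)|exact: (vC 5)].
have rotC k : C =i rot k [:: v0; v1; v2; v3; v4; v5] by move=> x; rewrite mem_rot CE.
have rotu k : uniq (rot k [:: v0; v1; v2; v3; v4; v5]) by rewrite rot_uniq.
have outer x : x \in C -> exists2 t, t \in T & e x t.
  by move=> xC; have [f [[_ fe] fT]] := Cpm x xC; exists (f x).
have [f0 [f0pm t0T]] := Cpm v0 v0C; have [f1 [f1pm t1T]] := Cpm v1 v1C.
have [f2 [f2pm t2T]] := Cpm v2 v2C.
have [x3 x3T e3] := outer v3 v3C; have [x4 x4T e4] := outer v4 v4C; have [x5 x5T e5] := outer v5 v5C.
have E0 := opposite_outer ncol CE uv (And4 e01 e12 e23 (And3 e34 e45 e50)) f0pm t0T x3T e3.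
have E1 := opposite_outer ncol (rotC 1) (rotu 1) (And4 e12 e23 e34 (And3 e45 e50 e01)) f1pm t1T x4T e4.
have E2 := opposite_outer ncol (rotC 2) (rotu 2) (And4 e23 e34 e45 (And3 e50 e01 e12)) f2pm t2T x5T e5.
have [_ /(_ v0) e0] := f0pm; have [_ /(_ v1) e1] := f1pm; have [_ /(_ v2) e2] := f2pm.
move: E0 E1 E2 e0 e1 e2 t0T t1T t2T; set t0 := f0 v0; set t1 := f1 v1; set t2 := f2 v2.
move=> E0 E1 E2 e0 e1 e2 t0T t1T t2T; subst x3 x4 x5.
clearbody t0 t1 t2; clear f0 f1 f2 f0pm f1pm f2pm x3T x4T x5T.
have t01 : t0 != t1.
  apply/eqP => E; subst t1; apply: (@no_four_nbrs t0 v0 v1 v3 v4); rewrite 1?es //.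
  exact: (mask_uniq uv [:: true; true; false; true; true]).
have t12 : t1 != t2.
  apply/eqP => E; subst t2; apply: (@no_four_nbrs t1 v1 v2 v4 v5); rewrite 1?es //.
  exact: (mask_uniq uv [:: false; true; true; false; true; true]).
have t02 : t0 != t2.
  apply/eqP => E; subst t2; apply: (@no_four_nbrs t0 v0 v2 v3 v5); rewrite 1?es //.
  exact: (mask_uniq uv [:: true; false; true; true; false; true]).
pose D := [set t0; t1; t2].
have cD : #|D| = 3 by rewrite /D setUC cardsU1 cards2 !inE negb_or ![t2 == _]eq_sym t02 t12 t01.
have DT : D \subset T by apply/subsetP => x; rewrite !inE -orbA => /or3P[]/eqP->.
have CnT x : x \in C -> x \in T = false.
  by move=> xC; apply: contraTF xC => xT; rewrite -in_setC AST inE xT orbT.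
have CnS x : x \in C -> x \in S = false.
  by move=> xC; apply: contraTF xC => xS; rewrite -in_setC AST inE xS.
have nbT x t y : x \in C -> t \in T -> y \in T -> e x t -> e x y -> y = t.
  move=> xC tT yT xt xy; have [_ cT] := NC xC.
  by apply/eqP; have := @nbr_exhaust T x [:: t] y; rewrite inE; apply => // z; rewrite inE => /eqP->.
have dCD : [disjoint C & D].
  by rewrite disjoint_sym disjoints_subset AST (subset_trans DT) // subsetUr.
pose W := C :|: D.
have ne2 (a b : V) : uniq [:: a; b] -> a != b by rewrite /= inE andbT.
have cutW : cut e W <= 3.
  rewrite /cut sum_setU // [X in X + _]big1 => [|x xC].
    rewrite add0n -cD -[X in _ <= X]muln1 -sum_nat_const; apply: leq_sum => t tD.
    have two a b : a \in C -> b \in C -> a != b -> e t a -> e t b -> nbr e (~: W) t <= 1.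
      move=> aC bC ab ta tb; have := deg3 t; rewrite -(nbr_setC e W) => H.
      have : nbr e [set a; b] t <= nbr e W t.
        by apply: nbrS; apply/subsetP => x; rewrite !inE => /orP[]/eqP->; rewrite ?aC ?bC.
      rewrite nbr_card; have -> : [set y in [set a; b] | e t y] = [set a; b].
        by apply/setP => y; rewrite !inE; apply: andb_idr => /orP[]/eqP->.
      by rewrite cards2 ab => H2; move: H; clear -H2; lia.
    move: tD; rewrite !inE -orbA => /or3P[]/eqP tE; subst t.
    + by apply: (two v0 v3) => //; rewrite 1?es // ne2 // (mask_uniq uv [:: true; false; false; true]).
    + by apply: (two v1 v4) => //; rewrite 1?es // ne2 // (mask_uniq uv [:: false; true; false; false; true]).
    by apply: (two v2 v5) => //; rewrite 1?es // ne2 // (mask_uniq uv [:: false; false; true; false; false; true]).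
  apply: nbr0 => y; rewrite inE => yW; apply: contra yW => xy; rewrite inE.
  have [//|yC] := boolP (y \in C).
  have yT : y \in T.
    have : y \in S :|: T by rewrite -AST inE.
    by rewrite inE => /orP[yS|//]; rewrite es in xy; have := NS yS xy; rewrite CnT.
  have ex t : t \in D -> e x t -> y \in D by move=> tD xt; rewrite (nbT x t y) // (subsetP DT).
  have D0 : t0 \in D by rewrite !inE eqxx.
  have D1 : t1 \in D by rewrite !inE eqxx orbT.
  have D2 : t2 \in D by rewrite !inE eqxx orbT.
  move: xC; rewrite CE ![x \in _ :: _]inE => /or4P[|||/or3P[]] /eqP xE; subst x.
  + exact: ex D0 e0.
  + exact: ex D1 e1.
  + exact: ex D2 e2.
  + exact: ex D0 e3.
  + exact: ex D1 e4.
  exact: ex D2 e5.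
have cW : 1 < #|W|.
  by rewrite (leq_trans _ (subset_leq_card (subsetUl C D))) // (eq_card CE) (card_uniqP uv).
have cS : 0 < #|S| by have := subset_leq_card DT; rewrite cD cST; clear; lia.
have SW : S \subset ~: W.
  apply/subsetP => x xS; rewrite in_setC in_setU; apply/norP; split.
    by apply: contraTN xS => /CnS->.
  by apply/negP => /(subsetP DT) xT; rewrite (disjointFr dST xS) in xT.
have cW' : 0 < #|~: W| by apply: leq_trans cS (subset_leq_card SW).
have W0 : W != set0 by rewrite -card_gt0 (leq_trans _ cW).
have W1 : ~: W != set0 by rewrite -card_gt0.
have [_ /(_ cutW)] := cut3 W0 W1; rewrite leqNgt cW /= => cW1.
have /eqP/esym SE : S == ~: W by rewrite eqEcard SW (leq_trans cW1).
have /eqP/cards1P[s sE] : #|S| = 1 by apply/eqP; rewrite eqn_leq cS -SE cW1.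
have TE : T = D.
  by apply/esym/eqP; rewrite eqEcard DT cD cST sE cards1.
have sS : s \in S by rewrite sE inE.
have sT y : y \in D -> e s y.
  have : [set y in T | e s y] == T.
    rewrite eqEcard -nbr_card nbr_sub_full ?deg3 ?TE ?cD ?leqnn ?andbT.
      by apply/subsetP => x; rewrite inE => /andP[].
    by rewrite -TE => z; apply: NS.
  by move/eqP/setP/(_ y); rewrite inE -TE => H yT; move: H; rewrite yT.
(* The outer pentagon is [s t0 v0 v1 t1], with spokes to [t2 v3 v5 v2 v4]; the inner pentagram runs
   through [t2 v5 v4 v3 v2]. *)
exists [:: s; t0; v0; v1; t1; t2; v3; v5; v2; v4]; split=> //.
- have perm := perm_petersen10 s t0 v0 v1 t1 t2 v3 v5 v2 v4.
  rewrite (perm_uniq perm) -[_ :: _]/([:: v0; v1; v2; v3; v4; v5] ++ [:: t0; t1; t2; s]).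
  have tsC y : y \in [:: t0; t1; t2; s] -> y \notin [:: v0; v1; v2; v3; v4; v5].
    have : all (fun y => y \in S :|: T) [:: t0; t1; t2; s].
      by rewrite /= !in_setU sS t0T t1T t2T !orbT.
    by move=> /allP H /H; rewrite -AST in_setC CE.
  rewrite cat_uniq uv; apply/and3P; split=> //; first by apply/hasPn => y /tsC.
  have nsT t : t \in T -> t != s by apply: contraTneq => ->; rewrite (disjointFr dST sS).
  by rewrite /= !inE !negb_or t01 t02 t12 !nsT.
- move=> x; rewrite (perm_mem (perm_petersen10 s t0 v0 v1 t1 t2 v3 v5 v2 v4)).
  rewrite -[_ :: _]/([:: v0; v1; v2; v3; v4; v5] ++ [:: t0; t1; t2; s]) mem_cat -CE.
  have [//|xC] := boolP (x \in C).
  have : x \in S :|: T by rewrite -AST inE.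
  by rewrite sE TE !inE => /orP[->|/orP[/orP[]|] ->]; rewrite ?orbT.
move=> x0; have [s0 s1 s2] : [/\ e s t0, e s t1 & e s t2].
  by split; apply: sT; rewrite !inE eqxx ?orbT.
rewrite /= s0 (es t0 v0) e0 e01 e1 (es t1 s) s1 s2 (es t0 v3) e3 (es v0 v5) e50 e12.
by rewrite (es t1 v4) e4 (es t2 v5) e5 (es v5 v4) e45 (es v4 v3) e34 (es v3 v2) e23 e2.
Qed.
End Bipartite.
End Cubic.

(** * The hexagonal core *)

Lemma involution_even (T : finType) (f : T -> T) :
  involutive f -> (forall x, f x != x) -> ~~ odd #|T|.
Proof.
move=> fK fN; have [x _|T0] := pickP T; last by rewrite (eq_card0 T0).
have fI := inv_inj fK.
rewrite -cardsT (cardsD1 (f x)) inE /= negbK.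
apply: (card_odd_invol_fix (a := x) fK) => //; rewrite ?inE 1?eq_sym ?fN ?eqxx //.
move=> y _ yx; by rewrite !inE (inj_eq fI) yx.
Qed.

(** Two pairings without a common pair form alternating cycles of even length at least four, and six
    points admit only one such cycle. *)
Lemma alternating_hexagon (V : finType) (D : {set V}) (U d : V -> V) : #|D| = 6 ->
  {in D, forall x, [/\ U x \in D, U (U x) = x & U x != x]} ->
  {in D, forall x, [/\ d x \in D, d (d x) = x & d x != x]} ->
  {in D, forall x, U x != d x} ->
  exists v0 v1 v2 v3 v4 v5, [/\ D =i [:: v0; v1; v2; v3; v4; v5],
    uniq [:: v0; v1; v2; v3; v4; v5],
    [/\ v1 = U v0, v3 = U v2 & v5 = U v4] & [/\ v2 = d v1, v4 = d v3 & v0 = d v5]].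
Proof.
move=> D6 HU Hd HUd.
have UD x : x \in D -> U x \in D by case/HU.
have UK x : x \in D -> U (U x) = x by case/HU.
have UN x : x \in D -> U x != x by case/HU.
have dD x : x \in D -> d x \in D by case/Hd.
have dK x : x \in D -> d (d x) = x by case/Hd.
have dN x : x \in D -> d x != x by case/Hd.
have [v0 D0] : exists v0, v0 \in D by apply/card_gt0P; rewrite D6.
have D1 := UD _ D0; have K0 := UK _ D0; set v1 := U v0 in D1 K0.
have D2 := dD _ D1; have K1 := dK _ D1; set v2 := d v1 in D2 K1.
have D3 := UD _ D2; have K2 := UK _ D2; set v3 := U v2 in D3 K2.
have D4 := dD _ D3; have K3 := dK _ D3; set v4 := d v3 in D4 K3.
have D5 := UD _ D4; have K4 := UK _ D4; set v5 := U v4 in D5 K4.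
have n10 : v1 != v0 by exact: UN.
have n21 : v2 != v1 by exact: dN.
have n20 : v2 != v0 by apply: contraNneq (HUd _ D1) => E; rewrite K0 -E.
have n32 : v3 != v2 by exact: UN.
have n31 : v3 != v1 by apply: contraNneq n20 => E; rewrite -K2 E K0.
have n30 : v3 != v0 by apply: contraNneq n21 => E; rewrite -K2 E.
have n43 : v4 != v3 by exact: dN.
have n42 : v4 != v2 by apply: contraNneq (HUd _ D3) => E; rewrite K2 -E.
have n41 : v4 != v1 by apply: contraNneq n32 => E; rewrite -K3 E.
(* Otherwise a 4-cycle closes, and a point [w] off it would bring [U w] and [d w] along: seven
   points in all. *)
have n40 : v4 != v0.
  apply/eqP => E; pose l := [:: v0; v1; v2; v3].
  have [w] : exists w, w \in D :\: [set x in l].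
    apply/card_gt0P; rewrite cardsD subn_gt0 D6.
    apply: leq_ltn_trans (subset_leq_card (subsetIr _ _)) _.
    by rewrite cardsE (leq_ltn_trans (card_size _)).
  rewrite in_setD in_set => /andP[wl wD].
  have stable (h : V -> V) x : h (h x) = x -> all (fun y => h y \in l) l -> x \notin l -> h x \notin l.
    by move=> hK /allP hl; apply: contra => /hl; rewrite hK.
  have Ul : U w \notin l by apply: stable; rewrite ?UK //= -/v1 K0 -/v3 K2 !inE !eqxx !orbT.
  have dl : d w \notin l.
    apply: stable; rewrite ?dK //= -{1}E K3 -/v2 K1 -/v4 E !inE !eqxx !orbT //.
  have ul : uniq l by rewrite /= !inE !negb_or ![_ == v1]eq_sym ![_ == v2]eq_sym ![_ == v3]eq_sym n10 n20 n30 n21 n31 n32.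
  have u7 : uniq (w :: U w :: d w :: l).
    have := HUd w wD; have := UN w wD; have := dN w wD.
    rewrite 3!cons_uniq ul andbT 2!(in_cons _ _ w) (in_cons _ _ (U w)).
    rewrite (negbTE wl) (negbTE Ul) (negbTE dl) !orbF andbT.
    by rewrite ![_ == w]eq_sym negb_or => -> -> ->.
  have sub : {subset w :: U w :: d w :: l <= enum D}.
    by apply/allP; rewrite /= !mem_enum wD UD // dD // D0 D1 D2 D3.
  by have := uniq_leq_size u7 sub; rewrite -cardE D6.
have n54 : v5 != v4 by exact: UN.
have n53 : v5 != v3 by apply: contraNneq n42 => E; rewrite -K4 E K2.
have n52 : v5 != v2 by apply: contraNneq n43 => E; rewrite -K4 E.
have n51 : v5 != v1 by apply: contraNneq n40 => E; rewrite -K4 E K0.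
have n50 : v5 != v0 by apply: contraNneq n41 => E; rewrite -K4 E.
pose l := [:: v0; v1; v2; v3; v4; v5].
have ul : uniq l.
  rewrite /= !inE !negb_or ![_ == v1]eq_sym ![_ == v2]eq_sym ![_ == v3]eq_sym ![_ == v4]eq_sym.
  by rewrite ![_ == v5]eq_sym n10 n20 n30 n40 n50 n21 n31 n41 n51 n32 n42 n52 n43 n53 n54.
have Dl : D =i l.
  have lD : {subset l <= enum D}.
    by apply/allP; rewrite /= !mem_enum D0 D1 D2 D3 D4 D5.
  have [|_ H] := uniq_min_size ul lD; first by rewrite -cardE D6.
  by move=> x; rewrite H mem_enum.
exists v0, v1, v2, v3, v4, v5; split=> //; split=> //.
have K5 := dK _ D5; have := dD _ D5; rewrite Dl !inE => /or4P[/eqP//|/eqP E|/eqP E|/or3P[]/eqP E].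
- by move: n52; rewrite -K5 E -/v2 eqxx.
- by move: n51; rewrite -K5 E K1 eqxx.
- by move: n54; rewrite -K5 E -/v4 eqxx.
- by have := HUd _ D5; rewrite K4 E eqxx.
by have := dN _ D5; rewrite E eqxx.
Qed.

Section Core.
Variables (V : finType) (e : rel V).
Hypothesis (es : symmetric e) (ei : irreflexive e).
Hypothesis deg3 : forall x, nbr e setT x = 3.
Hypothesis cut3 : forall W : {set V}, W != set0 -> ~: W != set0 ->
  3 <= cut e W /\ (cut e W <= 3 -> (#|W| <= 1) || (#|~: W| <= 1)).
Variables f1 f2 f3 : V -> V.
Hypotheses (pm1 : pm e f1) (pm2 : pm e f2) (pm3 : pm e f3).

Definition uncovered : rel V := fun x y => e x y && (y \notin [:: f1 x; f2 x; f3 x]).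

Lemma uncovered_sym : symmetric uncovered.
Proof.
have [[K1 _] [K2 _] [K3 _]] := And3 pm1 pm2 pm3.
have S (f : V -> V) : involutive f -> forall x y, (y == f x) = (x == f y).
  by move=> fK x y; apply/eqP/eqP => ->; rewrite fK.
by move=> x y; rewrite /uncovered es !inE (S f1) // (S f2) // (S f3).
Qed.

(** The right-hand side is three minus the number of distinct values among [f1 x], [f2 x],
    [f3 x]. *)
Lemma uncovered_deg x : nbr uncovered setT x =
  ((f1 x == f2 x) || (f1 x == f3 x)) + (f2 x == f3 x).
Proof.
have [[_ E1] [_ E2] [_ E3]] := And3 pm1 pm2 pm3.
have := deg3 x; rewrite !nbr_card => H.
have := cardsID [set f1 x; f2 x; f3 x] [set y in setT | e x y]; rewrite H.
have -> : [set y in setT | e x y] :&: [set f1 x; f2 x; f3 x] = f1 x |: [set f2 x; f3 x].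
  apply/setP => y; rewrite !inE /= -orbA; apply: andb_idl => /or3P[]/eqP->; auto.
have -> : [set y in setT | e x y] :\: [set f1 x; f2 x; f3 x] = [set y in setT | uncovered x y].
  by apply/setP => y; rewrite !inE /uncovered !inE andbC orbA.
rewrite cardsU1 cards2 !inE; move: (#|_|) => m.
by case: eqP; case: eqP; case: eqP => /= *; lia.
Qed.

(* A triply covered edge would be met by four uncovered edges, using up two
   thirds of the six uncovered darts; their far ends need four more. *)
Lemma uncovered_deg_le1 x : \sum_y nbr uncovered setT y = 6 -> nbr uncovered setT x <= 1.
Proof.
move=> sum6; rewrite leqNgt; apply/negP => k2; move: (k2); rewrite uncovered_deg => k2'.
have [E12 E23] : f1 x = f2 x /\ f2 x = f3 x.
  move: k2'; case: (f2 x =P f3 x) => [->|_]; last by case: (_ || _).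
  by rewrite orbb; case: eqP.
have [[K1 N1] [K2 N2] [K3 N3]] := And3 pm1 pm2 pm3.
set q := f1 x in E12; have xq : x != q by rewrite eq_sym; apply: contraTneq (N1 x) => E; rewrite -/q E ei.
have kq : nbr uncovered setT q = 2.
  have [Q1 [Q2 Q3]] : f1 q = x /\ f2 q = x /\ f3 q = x.
    by rewrite K1 E12 K2 E23 K3.
  by rewrite uncovered_deg Q1 Q2 Q3 eqxx.
have kx : nbr uncovered setT x = 2.
  by move: k2; rewrite uncovered_deg; do 2!case: (_ == _) => //=; case: (_ == _).
pose P := [set x; q].
have inP y : y \in P -> nbr uncovered (~: P) y = 2.
  move=> yP; rewrite -[RHS](_ : nbr uncovered setT y = 2); last first.
    by move: yP; rewrite !inE => /orP[]/eqP->.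
  apply: nbr_sub_full => z uyz; rewrite !inE negb_or; move: yP uyz; rewrite !inE.
  move=> /orP[]/eqP->; rewrite /uncovered => /andP[eyz]; rewrite !inE !negb_or.
    by move=> /andP[-> _]; rewrite andbT; apply: contraTneq eyz => ->; rewrite ei.
  by rewrite /q K1 => /andP[-> _]; apply: contraTneq eyz => ->; rewrite ei.
have : \sum_(y in P) nbr uncovered (~: P) y = 4.
  by rewrite (eq_bigr _ inP) sum_nat_const cards2 xq.
rewrite (sum_nbrC uncovered_sym) => s4.
have : \sum_(y in ~: P) nbr uncovered P y <= \sum_(y in ~: P) nbr uncovered setT y.
  by apply: leq_sum => y _; rewrite nbrS ?subsetT.
move: sum6; rewrite (bigID (mem P)) /= s4.
have -> : \sum_(i in P) nbr uncovered setT i = 4.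
  rewrite (eq_bigr (fun=> 2)) ?sum_nat_const ?cards2 ?xq // => y.
  by rewrite !inE => /orP[]/eqP->.
have -> : \sum_(i | i \notin P) nbr uncovered setT i = \sum_(i in ~: P) nbr uncovered setT i.
  by apply: eq_bigl => y; rewrite !inE.
by clear; lia.
Qed.

(** On the set [D] of vertices meeting an uncovered edge, [U] gives the other end of that edge and
    [d] the other end of the doubly covered one; together they trace the hexagon to which
    [pm_or_bipartite] is applied. *)
Lemma fourth_pm_or_petersen : ~ colourable e -> \sum_y nbr uncovered setT y = 6 ->
  (exists f4, pm e f4 /\ forall x y, uncovered x y -> y = f4 x) \/
  exists l, petersen_labelling e l.
Proof.
move=> ncol sum6; have k1 x := uncovered_deg_le1 x sum6.
have [[K1 N1] [K2 N2] [K3 N3]] := And3 pm1 pm2 pm3.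
pose D := [set x | 0 < nbr uncovered setT x].
have D6 : #|D| = 6.
  rewrite -sum6 -sum1_card big_mkcond; apply: eq_bigr => x _; rewrite inE.
  by case: (nbr _ _ x) (k1 x) => [|[]].
have DE x : (x \in D) = [|| f1 x == f2 x, f1 x == f3 x | f2 x == f3 x].
  by rewrite inE uncovered_deg; do 3!case: (_ == _).
pose U x := odflt x [pick y | uncovered x y].
have Uu x : x \in D -> uncovered x (U x).
  rewrite inE /U => kx; case: pickP => [y //|H]; move: kx; rewrite nbr0 // => y _; by rewrite H.
have Uuniq x y : uncovered x y -> y = U x.
  move=> uxy; have kx : 0 < nbr uncovered setT x by apply: nbr_gt0 uxy.
  have /eqP/cards1P[z zE] : #|[set y in setT | uncovered x y]| = 1.
    by rewrite -nbr_card; apply/eqP; rewrite eqn_leq k1.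
  have : y \in [set z] by rewrite -zE !inE.
  have : U x \in [set z] by rewrite -zE !inE Uu // inE.
  by move=> /set1P-> /set1P.
have HU : {in D, forall x, [/\ U x \in D, U (U x) = x & U x != x]}.
  move=> x xD; have uxU := Uu x xD; have uUx : uncovered (U x) x by rewrite uncovered_sym.
  split; first by rewrite inE; apply: nbr_gt0 uUx.
    by apply/esym/Uuniq.
  by apply: contraTneq uxU => ->; rewrite /uncovered ei.
(* The value taken at least twice by the three matchings at [x]; off [D], where there is none, the
   choice is arbitrary. *)
pose d x := if f1 x == f2 x then f1 x else if f1 x == f3 x then f1 x else f2 x.
have dne x : e x (d x) by rewrite /d; do 2!case: ifP => // _.
have dcov x : d x \in [:: f1 x; f2 x; f3 x].
  by rewrite /d; case: ifP => _; [|case: ifP => _]; rewrite !inE eqxx ?orbT.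
have dP y z : [|| (f1 y == z) && (f2 y == z), (f1 y == z) && (f3 y == z)
    | (f2 y == z) && (f3 y == z)] -> y \in D /\ d y = z.
  rewrite DE /d => /or3P[]/andP[/eqP-> /eqP->]; rewrite eqxx ?orbT; split=> //.
    by case: (_ == _).
  by case: (f1 y =P z).
have Hd : {in D, forall x, [/\ d x \in D, d (d x) = x & d x != x]}.
  move=> x xD; have [|dD dK] := dP (d x) x.
    rewrite !(inv_eq K1) !(inv_eq K2) !(inv_eq K3) ![d x == _]eq_sym.
    move: xD; rewrite DE /d; have [->|_] := eqVneq (f1 x) (f2 x); first by rewrite eqxx.
    have [->|_] /= := eqVneq (f1 x) (f3 x); first by rewrite eqxx !orbT.
    by move=> /eqP->; rewrite !eqxx !orbT.
  split=> //.
  by apply: contraTneq (dne x) => ->; rewrite ei.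
have HUd : {in D, forall x, U x != d x}.
  move=> x /Uu/andP[_]; apply: contraNneq => ->; exact: dcov.
have [v0 [v1 [v2 [v3 [v4 [v5 [DL ul [E1 E3 E5] [E2 E4 E0]]]]]]]] := alternating_hexagon D6 HU Hd HUd.
have ne x : x \in D -> e x (U x) by move/Uu/andP=> [].
have f1N x : f1 x != x by apply: contraTneq (N1 x) => ->; rewrite ei.
have evV := involution_even K1 f1N.
have evA : ~~ odd #|~: D| by move: evV; rewrite -(cardsC D) D6 oddD.
have pairD x : x \in D -> [set U x; d x] \subset D.
  move=> xD; have [UD _ _] := HU x xD; have [dD _ _] := Hd x xD.
  by apply/subsetP => y; rewrite !inE => /orP[]/eqP->; [move: UD|move: dD]; rewrite inE.
have two x : x \in D -> nbr e [set U x; d x] x = 2.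
  move=> xD; rewrite nbr_card; transitivity #|[set U x; d x]|; last by rewrite cards2 HUd.
  by apply: eq_card => y; rewrite !inE; apply: andb_idr => /orP[]/eqP->; [exact: ne|exact: dne].
have C2 x : x \in D -> 2 <= nbr e D x.
  by move=> xD; rewrite -(two x xD) nbrS // pairD.
have [[f [fK fe]]|[S [T [[AST dST cST] NS NT NC]]]] := pm_or_bipartite es ei deg3 cut3 evA D6 C2.
  (* The matching of the complement is completed on the hexagon by its three uncovered edges. *)
  left; exists (fun x => if x \in D then U x else f x); split; last first.
    move=> x y uxy; rewrite (Uuniq x y uxy).
    by have -> : x \in D by rewrite inE; apply: nbr_gt0 uxy.
  split=> x /=; have [xD|xD] := boolP (x \in D).
  - by have [-> -> _] := HU x xD.
  - have [] := fe x; first by rewrite in_setC.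
    by rewrite in_setC => /negbTE->; rewrite fK.
  - exact: ne.
  by have [] := fe x; rewrite ?in_setC.
clearbody D; right; apply: (petersen_of_bipartite es ei deg3 AST dST cST NS NT NC cut3 ncol DL ul).
  have [D0 D1 D2] : [/\ v0 \in D, v1 \in D & v2 \in D].
    by split; rewrite DL !inE eqxx ?orbT.
  have [D3 D4 D5] : [/\ v3 \in D, v4 \in D & v5 \in D].
    by split; rewrite DL !inE eqxx ?orbT.
  split; [by rewrite E1 ne|by rewrite E2 dne|by rewrite E3 ne|].
  by split; [rewrite E4 dne|rewrite E5 ne|rewrite E0 dne].
move=> x xD; have [cD _] := NC x xD.
(* Not all three matchings use the doubly covered edge at [x] and none uses the uncovered one, so
   one of them leaves the hexagon at [x]. *)
have [f [fpm fU fd]] : exists f, [/\ pm e f, f x != U x & f x != d x].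
  have HUx : U x \notin [:: f1 x; f2 x; f3 x] by have /andP[] := Uu x xD.
  move: HUx; rewrite !inE !negb_or ![U x == _]eq_sym => /and3P[u1 u2 u3].
  have : ~~ [&& f1 x == d x, f2 x == d x & f3 x == d x].
    apply/negP => /and3P[/eqP c1 /eqP c2 /eqP c3].
    by have := k1 x; rewrite uncovered_deg c1 c2 c3 eqxx.
  by rewrite !negb_and => /or3P[] h; [exists f1|exists f2|exists f3].
have [_ fe] := fpm; exists f; split=> //.
have fD : f x \notin D.
  apply/negP => fD; have := @nbr_exhaust _ e D x [:: U x; d x] (f x).
  rewrite [uniq _]/= [_ \in [:: d x]]inE HUd // !inE (negbTE fU) (negbTE fd) => H.
  suff: false by []. apply: H => // z; rewrite !inE => /orP[]/eqP->.
    by have [UD _ _] := HU x xD; split; last exact: ne.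
  by have [dD _ _] := Hd x xD; split.
have : f x \in S :|: T by rewrite -AST in_setC.
rewrite inE => /orP[fS|//]; have exf := fe x; rewrite es in exf.
have : x \in ~: D by rewrite AST inE (NS _ _ fS exf) orbT.
by rewrite in_setC xD.
Qed.
End Core.

(** * From multigraphs to simple graphs *)

Section Transfer.
Variables (V E : finType) (ends : E -> V * V).
Hypotheses (cub : cubic ends) (cyc : cyc_edge_connected ends 4).
Implicit Types (F M : {set E}) (W : {set V}).

Lemma adjP F x y : reflect (exists2 a, a \in F & joins ends a x y) (adj ends F x y).
Proof. by apply: (iffP existsP) => [[a /andP[]]|[a aF jo]]; exists a => //; rewrite aF. Qed.

Lemma adj_sym F : symmetric (adj ends F).
Proof. by move=> x y; apply/adjP/adjP => [][a aF]; exists a; rewrite // joinsC. Qed.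

Lemma joins_ends a : joins ends a (ends a).1 (ends a).2.
Proof. by rewrite /joins -surjective_pairing eqxx. Qed.

Lemma sum_deg F : \sum_v deg ends F v = (#|F|).*2.
Proof.
have S (h : E -> V) : \sum_v #|[set a in F | h a == v]| = #|F|.
  rewrite -[RHS]sum1_card (partition_big h predT) //=; apply: eq_bigr => v _.
  by rewrite -sum1_card; apply: eq_bigl => a; rewrite !inE.
by rewrite /deg big_split /= (S (fun a => (ends a).1)) (S (fun a => (ends a).2)) addnn.
Qed.

Lemma deg_set1 a x : deg ends [set a] x = ((ends a).1 == x) + ((ends a).2 == x).
Proof.
have S (P : pred E) : #|[set b in [set a] | P b]| = P a.
  case Pa: (P a).
    by rewrite (_ : [set b in _ | _] = [set a]) ?cards1 //; apply/setP => b;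
      rewrite !inE; apply: andb_idr => /eqP->.
  rewrite (_ : [set b in _ | _] = set0) ?cards0 //; apply/setP => b; rewrite !inE.
  by case: eqP => // ->.
by rewrite /deg !S.
Qed.

Lemma inner_cut W : 3 * #|W| = (#|inner_edges ends W|).*2 + #|cut_edges ends W|.
Proof.
have := deg_sum ends W; rewrite (eq_bigr (fun=> 3)) => [|v _]; last exact: cub.
by rewrite sum_nat_const mulnC.
Qed.

(** A vertex with a loop has at most one further edge end, and so a cut too small for [cut_bound]; a
    graph on that vertex alone would have odd degree sum. *)
Lemma no_loop a : (ends a).1 != (ends a).2.
Proof.
apply/eqP => loop; set v := (ends a).1 in loop.
have : 0 < #|inner_edges ends [set v]|.
  by apply/card_gt0P; exists a; rewrite !inE -loop eqxx.
have := inner_cut [set v]; rewrite cards1; set i := #|_|; set c := #|_| => ic i0.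
have c4 : c < 4 by clear -ic i0; lia.
have v0 : [set v] != set0 by rewrite -card_gt0 cards1.
have [v1|v1] := eqVneq (~: [set v]) set0.
  have : cut_edges ends [set v] = set0.
    by rewrite -cut_edgesC v1; apply/setP => b; rewrite !inE.
  by move/(congr1 (fun A : {set E} => #|A|)); rewrite cards0 -/c => c0; clear -ic c0; lia.
have := cut_bound cub cyc c4 v0 v1; rewrite cards1 -/c; clear -ic i0; lia.
Qed.

Hypothesis uncol : forall M1 M2 M3, perfect_matching ends M1 -> perfect_matching ends M2 ->
  perfect_matching ends M3 -> ~: (M1 :|: M2 :|: M3) != set0.

(** Two parallel edges leave at most two edges in the cut around their ends, which [cut_bound] rules
    out unless these are the only vertices. Then there are three edges, each a perfect matching, and
    they cover the graph. *)
Lemma simple a b x y : joins ends a x y -> joins ends b x y -> a = b.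
Proof.
move=> ja jb; apply/eqP; apply: contraT => ab.
have xy : x != y by apply: contraNneq (no_loop a) => ee; move: ja; rewrite ee /joins orbb => /eqP->.
pose W := [set x; y].
have inW c : joins ends c x y -> c \in inner_edges ends W.
  by case/orP => /eqP ee; rewrite !inE ee /= !eqxx ?orbT.
have : 2 <= #|inner_edges ends W|.
  have <- : #|[set a; b]| = 2 by rewrite cards2 ab.
  by apply: subset_leq_card; apply/subsetP => c /set2P[]->; apply: inW.
have := inner_cut W; rewrite {1}/W cards2 xy; set i := #|_|; set c := #|_| => ic i2.
have c4 : c < 4 by clear -ic i2; lia.
have W0 : W != set0 by rewrite -card_gt0 cards2.
have [W1|W1] := eqVneq (~: W) set0; last first.
  have := cut_bound cub cyc c4 W0 W1; rewrite {1}/W cards2 xy -/c.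
  by move: W1; rewrite -card_gt0; clear -ic i2; lia.
have Wx z : (z == x) || (z == y).
  by have : z \in ~: ~: W by [rewrite W1 setC0 inE]; rewrite setCK !inE.
have E3 : #|E| = 3.
  have := sum_deg setT; rewrite cardsT (eq_bigr (fun=> 3)) => [|v _]; last exact: cub.
  rewrite sum_nat_const; have -> : #|V| = 2; last by clear; lia.
  rewrite -cardsT; have -> : [set: V] = W by apply/setP => z; rewrite !inE Wx.
  by rewrite cards2 xy.
have pm1 z : perfect_matching ends [set z].
  move=> v; rewrite deg_set1; have := no_loop z.
  case/orP: (Wx (ends z).1) => /eqP->; case/orP: (Wx (ends z).2) => /eqP->; rewrite ?eqxx // => _.
    by case/orP: (Wx v) => /eqP->; rewrite eqxx ?(negbTE xy) // eq_sym (negbTE xy).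
  by case/orP: (Wx v) => /eqP->; rewrite eqxx ?(negbTE xy) // eq_sym (negbTE xy).
have : size (enum E) = 3 by rewrite -cardE.
case Een: (enum E) => [|p [|q [|r []]]] // _.
have := uncol (pm1 p) (pm1 q) (pm1 r).
suff -> : ~: ([set p] :|: [set q] :|: [set r]) = set0 by rewrite eqxx.
apply/setP => z; have : z \in enum E by rewrite mem_enum.
by rewrite Een !inE -orbA => ->.
Qed.

Lemma adj_irr F : irreflexive (adj ends F).
Proof.
move=> x; case: adjP => // -[a _]; rewrite /joins orbb => /eqP ee.
by have := no_loop a; rewrite ee eqxx.
Qed.

Lemma adj_card F x : #|[set y | adj ends F x y]| = deg ends F x.
Proof.
pose A := [set a in F | (ends a).1 == x]; pose B := [set a in F | (ends a).2 == x].
have AB : A :&: B = set0.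
  apply/setP => a; rewrite !inE; apply/negP => /andP[/andP[_ /eqP a1] /andP[_ /eqP a2]].
  by have := no_loop a; rewrite a1 a2 eqxx.
have -> : deg ends F x = #|A :|: B| by rewrite cardsU AB cards0 subn0.
pose other a := if (ends a).1 == x then (ends a).2 else (ends a).1.
have jo a : a \in A :|: B -> joins ends a x (other a).
  rewrite !inE /other /joins; case: (ends a) => p q /= /orP[]/andP[_ /eqP->].
    by rewrite !eqxx.
  by case: (p =P x) => [->|_]; rewrite !eqxx ?orbT.
rewrite -(card_in_imset (f := other)) => [|a b aA bA ee]; last first.
  by apply: (simple (jo a aA)); rewrite ee; apply: jo.
apply: eq_card => y; rewrite inE; apply/adjP/imsetP => [[a aF ja]|[a aA ->]].
  exists a; last first.
    have := no_loop a; case/orP: ja => /eqP ee; rewrite /other ee /= ?eqxx //.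
    by case: eqP => // ->.
  by rewrite !inE aF; case/orP: ja => /eqP->; rewrite eqxx ?orbT.
exists a; last exact: jo.
by move: aA; rewrite !inE => /orP[]/andP[].
Qed.

Notation e := (adj ends setT).

Lemma adj_nbr F x : nbr (adj ends F) setT x = deg ends F x.
Proof. by rewrite nbr_card -adj_card; apply: eq_card => y; rewrite !inE. Qed.

(** Each cut edge, oriented out of [W], yields an ordered pair counted by [cut], and simplicity
    makes this injective. *)
Lemma cut_edges_le W : #|cut_edges ends W| <= cut e W.
Proof.
have -> : cut e W = #|[set p : V * V | [&& p.1 \in W, p.2 \in ~: W & e p.1 p.2]]|.
  rewrite /cut /nbr pair_big_dep /= -sum1_card big_mkcond [RHS]big_mkcond /=.
  by apply: eq_bigr => -[x y] _; rewrite !inE /=; case: (x \in W); case: (y \in W); case: (e x y).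
pose h a := if (ends a).1 \in W then ends a else ((ends a).2, (ends a).1).
rewrite -(card_in_imset (f := h)).
  apply: subset_leq_card; apply/subsetP => _ /imsetP[a + ->]; rewrite !inE /h.
  have ea : e (ends a).1 (ends a).2 by apply/adjP; exists a; rewrite ?joins_ends ?inE.
  case a1: (_ \in W); case a2: (_ \in W) => //= _; first by rewrite ?a1 ?a2.
  by rewrite ?a1 ?a2 /= adj_sym.
move=> a b _ _ hab; have J c : joins ends c (h c).1 (h c).2.
  by rewrite /h; case: ifP => _; rewrite ?joins_ends // joinsC joins_ends.
by apply: (simple (J a)); rewrite hab; apply: J.
Qed.

Lemma adj_cut W : W != set0 -> ~: W != set0 ->
  3 <= cut e W /\ (cut e W <= 3 -> (#|W| <= 1) || (#|~: W| <= 1)).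
Proof.
move=> W0 W1; have le := cut_edges_le W.
have H : cut e W < 4 -> (#|W| + 2 <= cut e W) || (#|~: W| + 2 <= cut e W).
  move=> c4; case/orP: (cut_bound cub cyc (leq_ltn_trans le c4) W0 W1) => h.
    by rewrite (leq_trans h le).
  by rewrite (leq_trans h le) orbT.
move: W0 W1 H; rewrite -!card_gt0; move: (cut _ _) (#|W|) (#|~: W|); clear; lia.
Qed.

Lemma pm_of_matching M : perfect_matching ends M -> exists f, pm e f /\
  forall a x y, joins ends a x y -> (a \in M) = (y == f x).
Proof.
move=> pmM.
have ex x : exists y, [set y | adj ends M x y] == [set y].
  by have /eqP/cards1P[y ->] : #|[set y | adj ends M x y]| = 1 by [rewrite adj_card pmM]; exists y.
pose f x := xchoose (ex x).
have fE x y : adj ends M x y = (y == f x).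
  by have /eqP/setP/(_ y) := xchooseP (ex x); rewrite !inE.
have fM x : adj ends M x (f x) by rewrite fE.
exists f; split; [split=> x|move=> a x y ja].
- by apply/esym/eqP; rewrite -fE adj_sym.
- by have /adjP[a _ ja] := fM x; apply/adjP; exists a.
rewrite -fE; apply/idP/adjP => [aM|[b bM jb]]; first by exists a.
by rewrite (simple ja jb).
Qed.

Definition matching_of (f : V -> V) := [set a | f (ends a).1 == (ends a).2].

Lemma mem_matching_of f a x y : involutive f -> joins ends a x y ->
  (a \in matching_of f) = (y == f x).
Proof.
move=> fK; rewrite inE => /orP[]/eqP-> /=; first by rewrite eq_sym.
by rewrite (inv_eq fK).
Qed.

Lemma matching_of_pm f : pm e f -> perfect_matching ends (matching_of f).
Proof.
move=> [fK fe] x; rewrite -adj_card.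
have -> : [set y | adj ends (matching_of f) x y] = [set f x]; last exact: cards1.
apply/setP => y; rewrite !inE; apply/adjP/eqP => [[a aM ja]|->].
  by apply/eqP; rewrite -(mem_matching_of fK ja).
by have /adjP[a _ ja] := fe x; exists a; rewrite // (mem_matching_of fK ja).
Qed.

Lemma adj_uncolourable : ~ colourable e.
Proof.
move=> [f1 [f2 [f3 [p1 p2 p3 cov]]]].
have := uncol (matching_of_pm p1) (matching_of_pm p2) (matching_of_pm p3).
suff -> : ~: (matching_of f1 :|: matching_of f2 :|: matching_of f3) = set0 by rewrite eqxx.
apply/setP => a; rewrite in_setC !in_setU in_set0.
have ja := joins_ends a; have [[K1 _] [K2 _] [K3 _]] := And3 p1 p2 p3.
rewrite (mem_matching_of K1 ja) (mem_matching_of K2 ja) (mem_matching_of K3 ja) -orbA.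
by rewrite cov //; apply/adjP; exists a.
Qed.

Definition petersen_adj i j := ((i, j) \in petersen_list) || ((j, i) \in petersen_list).

(** Every vertex of the Petersen list has three listed neighbours, which exhaust the three
    neighbours in the graph, so there is no further edge. *)
Lemma labelling_exact l x y : petersen_labelling e l -> e x y ->
  petersen_adj (index x l) (index y l).
Proof.
case=> ul sl full lab exy; pose s := [seq j <- iota 0 10 | petersen_adj (index x l) j].
have il z : index z l < 10 by rewrite -sl index_mem.
have s3 : size s = 3.
  have /allP : all (fun i => size [seq j <- iota 0 10 | petersen_adj i j] == 3) (iota 0 10) by [].
  by move/(_ (index x l)); rewrite mem_iota => /(_ (il x))/eqP.
have sP j : j \in s -> j < 10 /\ petersen_adj (index x l) j.
  by rewrite mem_filter mem_iota add0n => /andP[].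
have /mapP[j /sP[j10 pj] ->] : y \in map (nth x l) s; last by rewrite index_uniq ?sl.
apply: (@nbr_exhaust _ e setT x) => //.
- rewrite map_inj_in_uniq ?filter_uniq ?iota_uniq // => i j /sP[i10 _] /sP[j10 _] /eqP.
  by rewrite nth_uniq ?sl // => /eqP.
- move=> _ /mapP[j /sP[j10 pj] ->]; split; first by rewrite inE.
  have /allP lx := lab x; have ix := nth_index x (full x).
  by case/orP: pj => /lx /=; rewrite ix // adj_sym.
by rewrite size_map s3 -(cub x); apply: adj_nbr.
Qed.

(** An edge is sent to the position of its label pair in the list. Simplicity makes this injective,
    and both graphs have fifteen edges. *)
Lemma iso_of_labelling l : petersen_labelling e l -> graph_iso ends petersen_ends.
Proof.
move=> lab; have [ul sl full _] := lab.
have il z : index z l < 10 by rewrite -sl index_mem.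
pose fV x : 'I_10 := inord (index x l).
have fVv x : fV x = index x l :> nat by rewrite inordK.
have V10 : #|V| = 10.
  by rewrite -sl -(card_uniqP ul); apply: eq_card => x; rewrite full.
have E15 : #|E| = 15.
  have := sum_deg setT; rewrite cardsT (eq_bigr (fun=> 3)) => [|v _]; last exact: cub.
  by rewrite sum_nat_const V10; clear; lia.
pose P a : pred (nat * nat) := fun p =>
  (p == (index (ends a).1 l, index (ends a).2 l)) || (p == (index (ends a).2 l, index (ends a).1 l)).
have hP a : has (P a) petersen_list.
  have /(labelling_exact lab)/orP[] : e (ends a).1 (ends a).2.
  - by apply/adjP; exists a; rewrite ?joins_ends.
  - by move=> pa; apply/hasP; exists (index (ends a).1 l, index (ends a).2 l); rewrite // /P eqxx.
  by move=> pa; apply/hasP; exists (index (ends a).2 l, index (ends a).1 l); rewrite // /P eqxx orbT.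
pose fE a : 'I_15 := inord (find (P a) petersen_list).
have fEv a : fE a = find (P a) petersen_list :> nat by rewrite inordK // -has_find hP.
have fEP a : P a (nth (0, 0) petersen_list (fE a)) by rewrite fEv nth_find.
have iI x y : index x l = index y l -> x = y.
  by move=> ee; rewrite -(nth_index x (full x)) ee nth_index.
clear fEv; clearbody fE; exists fV, fE; split.
- apply: inj_card_bij; last by rewrite card_ord V10.
  by move=> x y /(congr1 val) /=; rewrite !fVv => /iI.
- apply: inj_card_bij; last by rewrite card_ord E15.
  move=> a b ee; move: (fEP a) (fEP b); rewrite -ee; move: (nth _ _ _) => p {ee}.
  have ja := joins_ends a; have jb := joins_ends b.
  rewrite /P => /orP[]/eqP->; rewrite !xpair_eqE => /orP[]/andP[/eqP/iI E1 /eqP/iI E2];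
    apply: (simple ja); rewrite E1 E2 // joinsC //.
move=> a; rewrite /petersen_ends; move: (fEP a); move: (nth _ _ _) => p.
by rewrite /P => /orP[]/eqP->; [left|right].
Qed.
End Transfer.

Theorem theorem1p2 (V E : finType) (ends : E -> V * V) :
  cubic ends -> bridgeless ends -> cyc_edge_connected ends 4 ->
  colouring_defect ends 3 ->
  ~ graph_iso ends petersen_ends ->
  pm_index ends 4.
Proof.
move=> cub _ cyc [[M1 [M2 [M3 [p1 p2 p3 d3]]]] dmin] npet.
have uncol N1 N2 N3 : perfect_matching ends N1 -> perfect_matching ends N2 ->
    perfect_matching ends N3 -> ~: (N1 :|: N2 :|: N3) != set0.
  by move=> q1 q2 q3; rewrite -card_gt0 (leq_trans _ (dmin _ _ _ q1 q2 q3)).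
split; last first.
  move=> s sM cov; rewrite leqNgt ltnS; apply/negP => s3.
  (* A list of fewer than four matchings is padded with [M1] to exactly three, which leave some edge
     uncovered. *)
  pose N i := nth M1 s i.
  have pN i : perfect_matching ends (N i).
    have [si|si] := ltnP i (size s); first by apply: sM; rewrite mem_nth.
    by rewrite /N nth_default.
  have /negP := uncol _ _ _ (pN 0) (pN 1) (pN 2); apply; apply/eqP/setP => a.
  have [M Ms aM] := cov a; rewrite in_setC !in_setU in_set0.
  have := nth_index M1 Ms; have : index M s < 3 by rewrite (leq_trans _ s3) ?index_mem.
  by case: (index M s) => [|[|[|]]] // _; rewrite /N => ->; rewrite aM ?orbT.
have [f1 [q1 E1]] := pm_of_matching cub cyc uncol p1.
have [f2 [q2 E2]] := pm_of_matching cub cyc uncol p2.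
have [f3 [q3 E3]] := pm_of_matching cub cyc uncol p3.
pose F := ~: (M1 :|: M2 :|: M3).
have uE x y : uncovered (adj ends setT) f1 f2 f3 x y = adj ends F x y.
  apply/andP/adjP => [[/adjP[a _ ja]]|[a aF ja]].
    rewrite !inE -(E1 a) // -(E2 a) // -(E3 a) // => aM.
    by exists a; rewrite // !inE -orbA.
  split; first by apply/adjP; exists a.
  by move: aF; rewrite !inE -(E1 a) // -(E2 a) // -(E3 a) // -orbA.
(* Each of the three uncovered edges is counted from both of its ends. *)
have sum6 : \sum_x nbr (uncovered (adj ends setT) f1 f2 f3) setT x = 6.
  rewrite (eq_bigr (deg ends F)) ?sum_deg ?d3 // => x _.
  rewrite -(adj_nbr cub cyc uncol F); apply: eq_bigr => y _; by rewrite uE.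
have deg3 x : nbr (adj ends setT) setT x = 3 by rewrite (adj_nbr cub cyc uncol) cub.
have [[f4 [q4 cov]]|[l lab]] := fourth_pm_or_petersen (adj_sym ends setT) (adj_irr cub cyc setT)
    deg3 (adj_cut cub cyc uncol) q1 q2 q3 (adj_uncolourable cub cyc uncol) sum6; last first.
  by case: npet; apply: iso_of_labelling lab.
exists [:: M1; M2; M3; matching_of ends f4]; split=> //.
  move=> M; rewrite !inE => /or4P[]/eqP-> //.
  exact: (matching_of_pm cub cyc uncol q4).
move=> a; have [aF|aF] := boolP (a \in F).
  exists (matching_of ends f4); first by rewrite !inE eqxx !orbT.
  have [K4 _] := q4; rewrite (mem_matching_of K4 (joins_ends ends a)); apply/eqP/cov.
  by rewrite uE; apply/adjP; exists a; rewrite ?joins_ends.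
move: aF; rewrite !inE negbK -orbA => /or3P[] aM; [exists M1|exists M2|exists M3];
  by rewrite // !inE eqxx ?orbT.
Qed.
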